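(* For every hypergraph $\mathcal{C}$ we have $\operatorname{conn}(\operatorname{Ind}(\mathcal{C})) \geq \psi(\mathcal{C}) - 2$.
   Context: A hypergraph $\mathcal{C}$ on a finite vertex set $V$ is a family of pairwise incomparable subsets of $V$ (its edges), each of cardinality at least $2$; vertices lying in no edge are allowed (isolated vertices). The independence complex $\operatorname{Ind}(\mathcal{C})$ is the simplicial complex on $V$ whose faces are the subsets of $V$ containing no edge of $\mathcal{C}$ (if $V=\emptyset$ it is the complex $\{\emptyset\}$). For an edge $F$ of $\mathcal{C}$: $\mathcal{C}-F$ is the hypergraph on $V$ with edge set $\mathcal{C}\setminus\{F\}$; $N_{\mathcal{C}}(F)=\bigcup\{E\setminus F : E\in\mathcal{C},\ |E\setminus F|=1\}$; and $\mathcal{C}:F$ is the hypergraph on $V\setminus(F\cup N_{\mathcal{C}}(F))$ whose edges are the members of cardinality at least $2$ among the inclusion-minimal members of the family $\{E\setminus F : E\in \mathcal{C}-F\}$ (equivalently, $\operatorname{Ind}(\mathcal{C}:F)$ is the link of $F$ in $\operatorname{Ind}(\mathcal{C}-F)$). The number $\psi(\mathcal{C})\in\mathbb{Z}_{\ge 0}\cup\{\infty\}$ is defined recursively: $\psi(\mathcal{C})=0$ if $V=\emptyset$; $\psi(\mathcal{C})=\infty$ if $V\neq\emptyset$ and $\mathcal{C}$ has no edges; otherwise $\psi(\mathcal{C})=\max_{F\in\mathcal{C}}\min\{\psi(\mathcal{C}-F),\ \psi(\mathcal{C}:F)+|F|-1\}$. The homotopical connectivity $\operatorname{conn}(\Delta)$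 of a simplicial complex $\Delta$ is the largest integer $k\ge -1$ such that $\Delta$ is nonempty (has a vertex) and $\pi_i(\Delta)=0$ for all $0\le i\le k$; it is $\infty$ if all homotopy groups vanish, and $\operatorname{conn}(\{\emptyset\})=-2$. *)

(* Defs.v *)
From HB Require Import structures.
From mathcomp Require Import all_boot all_order all_algebra.
From mathcomp Require Import all_classical all_reals all_analysis.
Set Implicit Arguments. Unset Strict Implicit. Unset Printing Implicit Defensive.
Import Order.TTheory GRing.Theory Num.Theory.
Import numFieldNormedType.Exports.

(* A hypergraph is given by a vertex set W : {set V} inside an ambient finite
   type V, and an edge family C : {set {set V}}.  Extended naturals
   Z_{>=0} u {oo} are encoded as option nat, None = oo. *)
Section Hyp.
Variable V : finType.

Definition is_hypergraph (W : {set V}) (C : {set {set V}}) : Prop :=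
  (forall E, E \in C -> E \subset W) /\
  (forall E, E \in C -> 1 < #|E|) /\
  (forall E E', E \in C -> E' \in C -> E \subset E' -> E = E').

Definition emin (x y : option nat) : option nat :=
  match x, y with
  | None, _ => y | _, None => x | Some a, Some b => Some (minn a b) end.
Definition emax (x y : option nat) : option nat :=
  match x, y with
  | None, _ => None | _, None => None | Some a, Some b => Some (maxn a b) end.
Definition eaddn (x : option nat) (n : nat) : option nat := omap (addn^~ n) x.

Definition hnbhd (C : {set {set V}}) (F : {set V}) : {set V} :=
  \bigcup_(E in C | #|E :\: F| == 1) (E :\: F).
Definition colon_vs (W : {set V}) (C : {set {set V}}) (F : {set V}) :=
  W :\: (F :|: hnbhd C F).
Definition colon_edges (C : {set {set V}}) (F : {set V}) : {set {set V}} :=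
  let D := [set E :\: F | E in C :\ F] in
  [set G in D | [forall G' in D, (G' \subset G) ==> (G' == G)] && (1 < #|G|)].

(* psi, computed with fuel; fuel #|W| + #|C| + 1 suffices *)
Fixpoint psi_fuel (fuel : nat) (W : {set V}) (C : {set {set V}}) : option nat :=
  match fuel with
  | 0 => Some 0
  | fuel'.+1 =>
    if W == finset.set0 then Some 0
    else if C == finset.set0 then None
    else \big[emax/Some 0]_(F in C)
           emin (psi_fuel fuel' W (C :\ F))
                (eaddn (psi_fuel fuel' (colon_vs W C F) (colon_edges C F)) #|F|.-1)
  end.

Definition psi (W : {set V}) (C : {set {set V}}) : option nat :=
  psi_fuel (#|W| + #|C|).+1 W C.

Definition Ind (C : {set {set V}}) : {set {set V}} :=
  [set s : {set V} | [forall E in C, ~~ (E \subset s)]].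
End Hyp.

Local Open Scope ring_scope.
Local Open Scope classical_set_scope.
Section Topo.
Variable R : realType.

Definition geom_real (V : finType) (Delta : {set {set V}}) : set 'rV[R]_#|V| :=
  [set p : 'rV[R]_#|V| | (forall j, 0 <= p ord0 j) /\ \sum_j p ord0 j = 1 /\
           finset (fun v : V => p ord0 (enum_rank v) != 0) \in Delta].

Definition usphere (i : nat) : set 'rV[R]_i.+1 :=
  [set x | \sum_j x ord0 j ^+ 2 = 1].
Definition sph_pt (i : nat) : 'rV[R]_i.+1 :=
  \row_j (if j == ord0 then 1 else 0).

(* pi_i(X, x0) is trivial for every base point x0 in X: every based map
   (S^i, s0) -> (X, x0) is homotopic rel s0 to the constant map x0.
   (For i = 0 this says X is path-connected.) *)
Arguments usphere i : clear implicits.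
Arguments sph_pt i : clear implicits.

Definition unit_int : set R := [set t : R | 0 <= t <= 1].

Definition pi_trivial (n : nat) (X : set 'rV[R]_n) (i : nat) : Prop :=
  forall f : 'rV[R]_i.+1 -> 'rV[R]_n,
    {within (usphere i), continuous f} -> f @` (usphere i) `<=` X ->
    exists H : 'rV[R]_i.+1 * R -> 'rV[R]_n,
      [/\ {within (usphere i `*` unit_int), continuous H},
          H @` (usphere i `*` unit_int) `<=` X,
          (forall s, usphere i s -> H (s, 0) = f s /\ H (s, 1) = f (sph_pt i)) &
          (forall t, unit_int t -> H (sph_pt i, t) = f (sph_pt i))].

Definition conn_ge (V : finType) (Delta : {set {set V}}) (k : int) : Prop :=
  k <= -2 \/
  ((exists p, geom_real Delta p) /\
   (forall i : nat, (i%:Z <= k) -> pi_trivial (geom_real Delta) i)).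
End Topo.

(* Main.v *)
(* For an edge F put Delta = Ind(C - F) and L = lk_Delta(F) = Ind(C : F).  Then
   Ind(C) is Delta with the open star of F removed, and Delta is covered by two
   open sets: the complement of the barycenter of F, which retracts onto Ind(C),
   and the open star of F, which is contractible.  They meet in a copy of
   (boundary of F) * L times an open interval, and (boundary of F) * L is an
   iterated suspension of L, so its connectivity is at least
   conn(L) + |F| - 1.  Hence if both Delta and this intersection are k-connected,
   so is Ind(C), and the recursion for psi follows.

   Connectivity is handled as the extension of maps from the boundary of a cube
   to the cube.  For a cover X = U u V one subdivides the cube so finely that
   every small cube lands in U or in V and rebuilds the map skeleton by skeleton
   on the cells that have to be moved; this replaces van Kampen, Hurewicz and
   Mayer-Vietoris. *)
Require Import Defs.
From HB Require Import structures.
From mathcomp Require Import all_boot all_order all_algebra.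
From mathcomp Require Import all_classical all_reals all_analysis.
From mathcomp Require Import ring lra zify.
Import Order.TTheory GRing.Theory Num.Theory.
Import numFieldNormedType.Exports.
Local Open Scope ring_scope.
Local Open Scope classical_set_scope.
Set Implicit Arguments.
Unset Strict Implicit.
Unset Printing Implicit Defensive.

(** * Continuity on a subset *)

Section ContinuousOn.
Variables T S U : topologicalType.
Implicit Types (A B : set T) (f g : T -> S).

(** The pointwise form of [{within A, continuous f}]: the [cvg] lemmas on sums, products and
    inverses apply to these limits directly. *)
Definition cts_on (T S : topologicalType) (A : set T) (f : T -> S) :=
  forall x, A x -> f y @[y --> within A (nbhs x)] --> f x.

Lemma cts_onP A f : {within A, continuous f} <-> cts_on A f.
Proof. exact: subspace_continuousP. Qed.

Lemma cts_onS A B f : B `<=` A -> cts_on A f -> cts_on B f.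
Proof.
move=> BA /cts_onP fA; apply/cts_onP; exact: continuous_subspaceW BA fA.
Qed.

Lemma cts_on_eq A f g : (forall x, A x -> f x = g x) -> cts_on A f -> cts_on A g.
Proof.
move=> fg fA x Ax; rewrite -(fg _ Ax); apply: cvg_trans (fA x Ax).
by apply: fmap_within_eq => y; rewrite inE => /fg.
Qed.

Lemma cts_on_continuous A f : continuous f -> cts_on A f.
Proof. by move=> fc; apply/cts_onP; exact: continuous_subspaceT. Qed.

Lemma continuous_cts_onT f : cts_on setT f -> continuous f.
Proof.
move=> fT x W fW; have := fT x I W fW; rewrite /= !nbhs_simpl /within /=.
by apply: filterS => y; exact.
Qed.

Lemma cts_on_cst A (c : S) : cts_on A (fun=> c).
Proof. by move=> x _; exact: cvg_cst. Qed.

Lemma cts_on_comp A (B : set S) f (h : S -> U) :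
  (forall x, A x -> B (f x)) -> cts_on A f -> cts_on B h -> cts_on A (h \o f).
Proof.
move=> fAB fA hB x Ax; apply: cvg_comp (hB _ (fAB _ Ax)) => W.
move=> /= WB; have := fA _ Ax _ WB; rewrite /= !nbhs_simpl /within /=.
apply: filterS2 (_ : nbhs x (fun y => True)) => //=.
  by move=> y _ AW Ay; apply: AW => //; exact: fAB.
exact: filterT.
Qed.

Lemma cts_onU A B f : closed A -> closed B -> cts_on A f -> cts_on B f ->
  cts_on (A `|` B) f.
Proof.
by move=> cA cB /cts_onP fA /cts_onP fB; apply/cts_onP/withinU_continuous.
Qed.

(** The pasting lemma for finitely many closed sets. The induction carries closedness of the partial
    union along, because [cts_onU] asks for it. *)
Lemma closed_cts_on_finite_bigcup (I : finType) (P : I -> Prop)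
    (E : I -> set T) f :
  (forall i, closed (E i)) -> (forall i, P i -> cts_on (E i) f) ->
  cts_on [set x | exists2 i, P i & E i x] f.
Proof.
move=> Ecl fE.
pose F (s : seq I) := \big[setU/set0]_(i <- s | `[< P i >]) E i.
have -> : [set x | exists2 i, P i & E i x] = F (index_enum I).
  rewrite /F; apply/seteqP; split=> x.
    move=> [i Pi Eix]; rewrite -bigcup_seq_cond; exists i => //=.
    by rewrite mem_index_enum; apply/andP; split=> //; exact/asboolP.
  by rewrite -bigcup_seq_cond => -[i /= /andP[_ /asboolP Pi] Ei]; exists i.
suff : closed (F (index_enum I)) /\ cts_on (F (index_enum I)) f by case.
elim: (index_enum I) => [|i s [Fcl Fc]]; rewrite /F.
  by rewrite big_nil; split; [exact: closed0 | move=> x []].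
rewrite big_cons; case: asboolP => [Pi|_] //; split; first exact: closedU.
by apply: cts_onU => //; exact: fE.
Qed.

End ContinuousOn.

Section ContinuousOnNormed.
Variables (R : realType) (T : topologicalType) (A : set T).

Lemma cts_onD (V : normedModType R) (f g : T -> V) :
  cts_on A f -> cts_on A g -> cts_on A (fun x => f x + g x).
Proof. by move=> fA gA x Ax; apply: cvgD; [exact: fA|exact: gA]. Qed.

Lemma cts_onN (V : normedModType R) (f : T -> V) :
  cts_on A f -> cts_on A (fun x => - f x).
Proof. by move=> fA x Ax; apply: cvgN; exact: fA. Qed.

Lemma cts_onB (V : normedModType R) (f g : T -> V) :
  cts_on A f -> cts_on A g -> cts_on A (fun x => f x - g x).
Proof. by move=> fA gA; apply: cts_onD => //; exact: cts_onN. Qed.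

Lemma cts_onZ (V : normedModType R) (f : T -> R^o) (g : T -> V) :
  cts_on A f -> cts_on A g -> cts_on A (fun x => f x *: g x).
Proof. by move=> fA gA x Ax; apply: cvgZ; [exact: fA|exact: gA]. Qed.

Lemma cts_onM (f g : T -> R^o) :
  cts_on A f -> cts_on A g -> cts_on A (fun x => (f x : R) * g x : R^o).
Proof. by move=> fA gA x Ax; apply: cvgM; [exact: fA|exact: gA]. Qed.

Lemma cts_onV (f : T -> R^o) : (forall x, A x -> f x != 0) ->
  cts_on A f -> cts_on A (fun x => (f x : R)^-1 : R^o).
Proof. by move=> f0 fA x Ax; apply: cvgV; [exact: f0|exact: fA]. Qed.

Lemma cts_on_norm (V : normedModType R) (f : T -> V) :
  cts_on A f -> cts_on A (fun x => `|f x| : R^o).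
Proof. by move=> fA x Ax; apply: cvg_norm; exact: fA. Qed.

Lemma cts_on_sum (I : finType) (f : I -> T -> R^o) :
  (forall i, cts_on A (f i)) -> cts_on A (fun x => \sum_i f i x).
Proof.
move=> fA; elim: (index_enum I) => [|i s IHs].
  by apply: cts_on_eq (@cts_on_cst _ _ A 0) => x _; rewrite big_nil.
apply: (@cts_on_eq _ _ _ (fun x => f i x + \sum_(j <- s) f j x)).
  by move=> x _; rewrite big_cons.
exact: cts_onD.
Qed.

Lemma cts_on_coord n (f : T -> 'rV[R]_n) j :
  cts_on A f -> cts_on A (fun x => f x ord0 j : R^o).
Proof.
move=> fA; apply: (@cts_on_comp _ _ _ _ setT f (fun M => M ord0 j : R^o)) => //.
exact/cts_on_continuous/coord_continuous.
Qed.

Lemma cts_on_row n (f : T -> 'rV[R]_n) :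
  (forall j, cts_on A (fun x => f x ord0 j : R^o)) -> cts_on A f.
Proof.
move=> fA x Ax; apply/cvg_ballP => e e0.
have : \forall y \near within A (nbhs x),
    forall j, ball (f x ord0 j) e (f y ord0 j).
  by apply: filter_forall => j; move/cvg_ballP: (fA j x Ax) => /(_ e e0).
by apply: filterS => y fy; split=> // i j; rewrite ord1.
Qed.

End ContinuousOnNormed.
(** * Filling spheres *)

Definition extendable (T S : topologicalType) (A B : set T) (X : set S) :=
  forall f : T -> S, cts_on B f -> (forall x, B x -> X (f x)) ->
  exists g, [/\ cts_on A g, forall x, A x -> X (g x) &
                forall x, B x -> g x = f x].

(** Pull the boundary map back along [phi], extend it, and precompose with [psi]; [phi] has to undo
    [psi] only on [B']. *)
Lemma extendable_transfer (T T' S : topologicalType) (A B : set T)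
    (A' B' : set T') (X : set S) (phi : T -> T') (psi : T' -> T) :
  cts_on B phi -> (forall x, B x -> B' (phi x)) ->
  cts_on A' psi -> (forall x, A' x -> A (psi x)) ->
  (forall x, B' x -> B (psi x)) -> (forall x, B' x -> phi (psi x) = x) ->
  extendable A B X -> extendable A' B' X.
Proof.
move=> phic phiB psic psiA psiB phiK extAB f fc fX.
have [||g [gc gX gf]] := extAB (f \o phi).
- exact: cts_on_comp phic fc.
- by move=> x /phiB /fX.
exists (g \o psi); split.
- exact: cts_on_comp psic gc.
- by move=> x /psiA /gX.
- by move=> x B'x; rewrite [LHS]gf /= ?phiK //; exact: psiB.
Qed.

Section Fill.
Variable R : realType.
Implicit Type V : normedModType R.

Lemma rV_norm_le n (x : 'rV[R]_n) (M : R) : 0 <= M ->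
  (`|x| <= M) <-> (forall j, `|x ord0 j| <= M).
Proof.
move=> M0; rewrite [`|x|]mx_normrE; split=> [/bigmax_leP[_ h] j|h].
  exact: (h (ord0, j)).
by apply/bigmax_leP; split=> // -[i j] _; rewrite (ord1 i); exact: h.
Qed.

Lemma rV_norm_coord n (x : 'rV[R]_n) : x != 0 ->
  exists j, `|x| = `|x ord0 j|.
Proof.
rewrite -normr_eq0 => x0; have [[i j] xE] := mx_norm_neq0 x0.
by exists j; rewrite [LHS]xE /= (ord1 i).
Qed.

(** The norm on row vectors is the maximum norm, so these are the cube [-1, 1]^n and its boundary,
    ready for cubical subdivision. *)
Definition cball n := [set x : 'rV[R]_n | `|x| <= 1].
Definition csphere n := [set x : 'rV[R]_n | `|x| = 1].
(* [fillable 0 X] says that [X] is nonempty: the sphere in dimension 0 is empty. *)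
Definition fillable (S : topologicalType) n (X : set S) :=
  extendable (@cball n) (@csphere n) X.

Lemma csphere_cball n : @csphere n `<=` @cball n.
Proof. by move=> x; rewrite /csphere /cball /= => ->. Qed.

Lemma cts_on_id n (A : set 'rV[R]_n) : cts_on A id.
Proof. by apply: cts_on_continuous => x. Qed.

Lemma closed_norm_le n r : closed [set x : 'rV[R]_n | `|x| <= r].
Proof.
apply: (@closed_comp _ _ (@Num.norm R 'rV[R]_n) [set y | y <= r]);
  last exact: closed_le.
by move=> x _; exact: norm_continuous.
Qed.

Lemma closed_norm_ge n r : closed [set x : 'rV[R]_n | r <= `|x|].
Proof.
apply: (@closed_comp _ _ (@Num.norm R 'rV[R]_n) [set y | r <= y]);
  last exact: closed_ge.
by move=> x _; exact: norm_continuous.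
Qed.

Lemma normalize_csphere n (x : 'rV[R]_n) : x != 0 -> csphere (`|x|^-1 *: x).
Proof.
by move=> x0; rewrite /csphere /= normrZ normfV normr_id mulVf// normr_eq0.
Qed.

Lemma cts_on_normalize n (A : set 'rV[R]_n) : (forall x, A x -> x != 0) ->
  cts_on A (fun x => `|x|^-1 *: x).
Proof.
move=> A0; apply: (@cts_onZ _ _ _ _ (fun x => `|x|^-1)); last exact: cts_on_id.
apply: cts_onV => [x /A0|]; first by rewrite normr_eq0.
exact: (@cts_on_norm _ _ _ _ id) (@cts_on_id _ _).
Qed.

(* On the inner half of the ball use the filling in [Z]; the collar carries the
   straight-line homotopy. *)
Lemma fillable_dominated V (W : topologicalType) (Y : set V) (Z : set W)
    (i : V -> W) (rho : W -> V) n :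
  cts_on Y i -> (forall y, Y y -> Z (i y)) ->
  cts_on Z rho ->
  (forall y, Y y -> forall t, 0 <= t <= 1 ->
     Y ((1 - t) *: y + t *: rho (i y))) ->
  (forall z, Z z -> Y (rho z)) ->
  fillable n Z -> fillable n Y.
Proof.
move=> ic iZ rhoc seg rhoY fillZ f fc fY.
have [||G [Gc GZ Gf]] := fillZ (i \o f).
- exact: cts_on_comp fc ic.
- by move=> x /fY /iZ.
pose e (x : 'rV[R]_n) := f (`|x|^-1 *: x).
(* [t] falls from 1 at radius 1/2, where [h] meets [rho (G (2 *: x))], to 0 on the boundary, where
   [h] is [f]. *)
pose t (x : 'rV[R]_n) : R := 2 - 2 * `|x|.
pose h x := (1 - t x) *: e x + t x *: rho (i (e x)).
pose g x := if `|x| <= 2^-1 then rho (G (2 *: x)) else h x.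
pose A1 := [set x : 'rV[R]_n | `|x| <= 2^-1].
pose A2 := @cball n `&` [set x : 'rV[R]_n | 2^-1 <= `|x|].
have A2n0 x : A2 x -> x != 0.
  by move=> [_ /= x2]; rewrite -normr_gt0; apply: lt_le_trans x2; lra.
have e_in x : A2 x -> csphere (`|x|^-1 *: x).
  by move=> /A2n0; exact: normalize_csphere.
have ec : cts_on A2 e.
  by apply: (cts_on_comp e_in _ fc); exact: cts_on_normalize.
have tc : cts_on A2 (t : _ -> R^o).
  apply: (@cts_onB _ _ _ R^o); first exact: cts_on_cst.
  apply: cts_onM; first exact: cts_on_cst.
  exact: (@cts_on_norm _ _ _ _ id) (@cts_on_id _ _).
have A2E x : A2 x -> g x = h x.
  move=> A2x; have [x1 /= x2] := A2x; rewrite /g; case: ifPn => // x2'.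
  have xE : `|x| = 2^-1 by apply/le_anti/andP.
  have -> : 2 *: x = `|x|^-1 *: x by rewrite xE invrK.
  rewrite Gf; last exact: e_in.
  rewrite /h /t xE mulfV ?pnatr_eq0// (_ : 2 - 1 = 1) ?subrr; last by lra.
  by rewrite scale0r add0r scale1r /e xE.
have gA1 : cts_on A1 g.
  apply: (@cts_on_eq _ _ _ (rho \o (G \o (fun x => 2 *: x)))).
    by move=> x; rewrite /A1 /g /= => ->.
  have A1b x : A1 x -> cball (2 *: x).
    by rewrite /A1 /cball /= normrZ ger0_norm//; lra.
  apply: cts_on_comp rhoc; first by move=> x /A1b /GZ.
  apply: cts_on_comp Gc => //.
  apply: (@cts_onZ _ _ _ _ (fun=> 2)); [exact: cts_on_cst|exact: cts_on_id].
have gA2 : cts_on A2 g.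
  apply: (@cts_on_eq _ _ _ h) => [x /A2E//|].
  apply: cts_onD.
    apply: (@cts_onZ _ _ _ _ (fun x => 1 - t x)) => //.
    by apply: (@cts_onB _ _ _ R^o) => //; exact: cts_on_cst.
  apply: (@cts_onZ _ _ _ _ t) => //.
  apply: (@cts_on_comp _ _ _ _ Z) rhoc; first by move=> x /e_in /fY /iZ.
  by apply: cts_on_comp ic => // x /e_in /fY.
exists g; split.
- apply: (@cts_onS _ _ (A1 `|` A2)).
    move=> x x1; case: (leP `|x| 2^-1) => h2; first by left.
    by right; split=> //=; exact: ltW.
  apply: cts_onU => //; first exact: closed_norm_le.
  by apply: closedI; [exact: closed_norm_le|exact: closed_norm_ge].
- move=> x; rewrite /cball /= => x1; case: (leP `|x| 2^-1) => h2.
    by rewrite /g h2; apply/rhoY/GZ; rewrite /cball /= normrZ ger0_norm//; lra.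
  have A2x : A2 x by split=> //=; exact: ltW.
  rewrite A2E// /h; apply: seg; first exact/fY/e_in.
  by rewrite /t; apply/andP; split; lra.
- move=> x; rewrite /csphere /= => x1.
  rewrite A2E; last by split; rewrite /cball /= x1//; lra.
  rewrite /h /t /e x1 invr1 scale1r (_ : 2 - 2 * 1 = 0) ?subr0; last by lra.
  by rewrite scale1r scale0r addr0.
Qed.

Lemma fillable_set1 (S : topologicalType) (p : S) n : fillable n [set p].
Proof.
move=> f fc fp; exists (fun=> p); split=> //; first exact: cts_on_cst.
by move=> x /fp.
Qed.

End Fill.
(** * Cubical subdivisions *)

Section GridIndex.
Variable R : realType.

(** For [t >= 0], an integer m gets 2 m and a point strictly between m and m + 1 gets 2 m + 1. Thus
    [./2] and [uphalf] of the index are the ends of the smallest grid interval around [t]. *)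
Definition gindex (t : R) : nat := (Num.truncn t).*2 + (t != (Num.truncn t)%:R).

Lemma half_gindex t : (gindex t)./2 = Num.truncn t.
Proof. by rewrite /gindex addnC half_bit_double. Qed.

Lemma uphalf_gindex t :
  uphalf (gindex t) = (Num.truncn t + (t != (Num.truncn t)%:R))%N.
Proof. by rewrite /gindex; case: eqP => _ /=; lia. Qed.

Lemma gindex_bounds t : 0 <= t ->
  ((gindex t)./2)%:R <= t <= (uphalf (gindex t))%:R.
Proof.
move=> t0; have /andP[t1 t2] := truncn_itv t0.
rewrite half_gindex uphalf_gindex t1 /=.
by case: eqP => [{1}->|_]; rewrite ?addn0 ?addn1// ltW.
Qed.

Lemma gindex_le (N : nat) t : 0 <= t <= N%:R -> (gindex t <= N.*2)%N.
Proof.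
move=> /andP[t0 tN]; have /andP[t1 t2] := truncn_itv t0.
have tr : (Num.truncn t <= N)%N by rewrite -(ler_nat R) (le_trans t1).
rewrite /gindex; case: eqVneq => [_|tn] /=; first by lia.
suff : (Num.truncn t < N)%N by lia.
by rewrite -(ltr_nat R) (lt_le_trans _ tN)// lt_neqAle eq_sym tn.
Qed.

Lemma gindex_face (k : nat) t : (k./2)%:R <= t <= (uphalf k)%:R ->
  (k./2 <= (gindex t)./2)%N /\ (uphalf (gindex t) <= uphalf k)%N.
Proof.
move=> /andP[kt tk]; have t0 : 0 <= t by apply: le_trans kt.
have /andP[t1 t2] := truncn_itv t0.
rewrite half_gindex uphalf_gindex; split.
  by rewrite -ltnS -(ltr_nat R) (le_lt_trans kt).
case: eqVneq => [_|tn] /=; first by rewrite addn0 -(ler_nat R) (le_trans t1).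
by rewrite addn1 -(ltr_nat R) (lt_le_trans _ tk)// lt_neqAle eq_sym tn.
Qed.

(** An odd [k] codes an interval, whose interior avoids both ends; an even [k] codes a point, which
    is its own interior. *)
Lemma gindex_eq (k : nat) t : (k./2)%:R <= t <= (uphalf k)%:R ->
  gindex t = k <-> (odd k -> t <> (k./2)%:R /\ t <> (uphalf k)%:R).
Proof.
move=> /andP[kt tk]; have t0 : 0 <= t by apply: le_trans kt.
have /andP[t1 t2] := truncn_itv t0; split.
  move=> <- odk; rewrite half_gindex uphalf_gindex.
  move: odk; rewrite /gindex oddD odd_double /=.
  case: eqVneq => //= tn _; split; first exact/eqP.
  by rewrite addn1 => tE; move: t2; rewrite {1}tE ltxx.
have [ok /(_ isT)[tn1 tn2]|ek _] := boolP (odd k).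
  have hk : uphalf k = k./2.+1 by lia.
  have trE : Num.truncn t = k./2.
    apply: truncn_def; rewrite kt /= -hk lt_neqAle tk andbT; exact/eqP.
  rewrite /gindex trE; case: eqP => //= _; lia.
have hk : uphalf k = k./2 by lia.
have tE : t = (k./2)%:R by apply/le_anti/andP; split=> //; rewrite -hk.
have trE : Num.truncn t = k./2 by rewrite tE natrK.
by rewrite /gindex trE tE eqxx; lia.
Qed.

Lemma face_odd a b : (a./2 <= b./2)%N -> (uphalf b <= uphalf a)%N ->
  (odd b -> odd a) /\ (a <> b -> odd a /\ ~~ odd b).
Proof. by split; lia. Qed.

End GridIndex.

Section Grid.
Variables (R : realType) (d N : nat).
(* The cube [-1, 1]^d is cut into N^d cubes.  In the coordinate
   N (t + 1) / 2, index 2 m stands for the point m and 2 m + 1 for the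
   interval [m, m + 1]. *)
Definition gscale (t : R) : R := N%:R * (t + 1) / 2.
Definition cell := {ffun 'I_d -> 'I_(N.*2).+1}.
Definition ecell (c : cell) := [set x : 'rV[R]_d | forall j,
  ((c j)./2)%:R <= gscale (x ord0 j) <= (uphalf (c j))%:R].
(** The cell whose relative interior contains [x]. On the cube [inord] is faithful, since
    [gindex_le] bounds the index. *)
Definition cell_of (x : 'rV[R]_d) : cell :=
  [ffun j => inord (gindex (gscale (x ord0 j)))].
Definition face (c' c : cell) := forall j,
  ((c j)./2 <= (c' j)./2)%N /\ (uphalf (c' j) <= uphalf (c j))%N.
Definition dimc (c : cell) := #|[pred j | odd (c j)]|.
(** The relative boundary: such a point is interior to another cell, which is a proper face of [c]
    by [face_cell_of]. *)
Definition bcell (c : cell) := [set x | ecell c x /\ cell_of x <> c].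

Lemma face_ecell c' c : face c' c -> ecell c' `<=` ecell c.
Proof.
move=> cc x c'x j; have [h1 h2] := cc j; have /andP[h3 h4] := c'x j.
by apply/andP; split; [apply: le_trans h3|apply: (le_trans h4)]; rewrite ler_nat.
Qed.

Lemma face_dim c' c : face c' c -> c' <> c -> (dimc c' < dimc c)%N.
Proof.
move=> cc ne; apply: proper_card; apply/properP; split.
  apply/fintype.subsetP => j; rewrite !inE.
  by have [h1 h2] := cc j; case: (face_odd h1 h2).
have [j jne] : exists j, c' j <> c j.
  by apply: contrapT => /forallNP h; apply: ne; apply/ffunP => j;
    exact: contrapT (h j).
have {}jne : (c j : nat) <> c' j by move=> /val_inj /esym.
have [h1 h2] := cc j; have [_ /(_ jne)[oj oj']] := face_odd h1 h2.
by exists j; rewrite !inE.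
Qed.

Lemma cts_on_gscale (T : topologicalType) (A : set T) (f : T -> R^o) :
  cts_on A f -> cts_on A (fun x => gscale (f x) : R^o).
Proof.
move=> fc; apply: cts_onM; last exact: cts_on_cst.
apply: cts_onM; first exact: cts_on_cst.
by apply: (@cts_onD _ _ _ R^o) => //; exact: cts_on_cst.
Qed.

Lemma closed_ecell c : closed (ecell c).
Proof.
pose f j (x : 'rV[R]_d) := gscale (x ord0 j) : R^o.
have fc j : continuous (f j).
  apply: continuous_cts_onT; apply: cts_on_gscale.
  exact: (@cts_on_coord _ _ _ _ id) (@cts_on_id _ _ _).
have -> : ecell c = \bigcap_(j in [set: 'I_d])
   (f j @^-1` [set y | ((c j)./2)%:R <= y] `&`
    f j @^-1` [set y | y <= (uphalf (c j))%:R]).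
  apply/seteqP; split=> x cx j; first by move=> _; have /andP[] := cx j.
  by have [h1 h2] := cx j I; apply/andP.
apply: closed_bigI => j _.
by apply: closedI; apply: closed_comp.
Qed.

Definition cell_mid (c : cell) j : R := ((c j)./2 + uphalf (c j))%:R / 2.

(** The coded interval has length 1 for an odd index and 0 for an even one, so twice the offset from
    the midpoint ranges over [-1, 1] or is 0. *)
Lemma gscale_midP (c : cell) j t :
  (((c j)./2)%:R <= gscale t <= (uphalf (c j))%:R) <->
  `|2 * (gscale t - cell_mid c j)| <= (odd (c j))%:R.
Proof.
have hk : uphalf (c j) = ((c j)./2 + odd (c j))%N by lia.
rewrite /cell_mid hk !natrD; move: ((c j)./2%:R) ((odd (c j))%:R) => a b.
by rewrite ler_norml; split=> /andP[h1 h2]; apply/andP; split; lra.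
Qed.

Hypothesis N_gt0 : (0 < N)%N.

Lemma gscale_itv t : (0 <= gscale t <= N%:R) = (`|t| <= 1).
Proof.
have N0 : 0 < N%:R :> R by rewrite ltr0n.
rewrite /gscale ler_norml -mulrA pmulr_rge0// ger_pMr//.
by apply/andP/andP => -[h1 h2]; split; lra.
Qed.

Lemma ecell_cball (c : cell) : ecell c `<=` @cball R d.
Proof.
move=> x cx; apply/rV_norm_le => // j; rewrite -gscale_itv.
have /andP[h1 h2] := cx j; rewrite (le_trans _ h1)//= (le_trans h2)// ler_nat.
by have := ltn_ord (c j); lia.
Qed.

Lemma cell_ofE x j : cball x -> cell_of x j = gindex (gscale (x ord0 j)) :> nat.
Proof.
move=> /rV_norm_le -/(_ ler01) /(_ j); rewrite -gscale_itv => xj.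
by rewrite ffunE inordK// ltnS gindex_le.
Qed.

Lemma ecell_cell_of x : cball x -> ecell (cell_of x) x.
Proof.
move=> xb j; rewrite cell_ofE//; apply: gindex_bounds.
move/rV_norm_le: xb => /(_ ler01) /(_ j); rewrite -gscale_itv.
by case/andP.
Qed.

Lemma face_cell_of c x : ecell c x -> face (cell_of x) c.
Proof.
move=> cx j; rewrite cell_ofE; last exact: ecell_cball cx.
exact: gindex_face.
Qed.

Lemma bcellP c x : ecell c x ->
  bcell c x <-> exists2 j, odd (c j) & `|2 * (gscale (x ord0 j) - cell_mid c j)| = 1.
Proof.
move=> cx; have xb := ecell_cball cx.
have E j : odd (c j) -> `|2 * (gscale (x ord0 j) - cell_mid c j)| = 1 <->
    ~ (gscale (x ord0 j) <> ((c j)./2)%:R /\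
       gscale (x ord0 j) <> (uphalf (c j))%:R).
  move=> oj; have hk : uphalf (c j) = ((c j)./2 + 1)%N by lia.
  rewrite /cell_mid hk !natrD; move: (gscale _) ((c j)./2%:R) => t a.
  split.
    move=> /eqP; rewrite eqr_norml => /andP[/orP[]/eqP h _] [h1 h2].
      by apply: h2; lra.
    by apply: h1; lra.
  have [->|ta] := eqVneq t a => [_|].
    by rewrite (_ : 2 * _ = - 1) ?normrN1//; lra.
  have [->|ta'] := eqVneq t (a + 1) => [_|[]]; last by split; exact/eqP.
  by rewrite (_ : 2 * _ = 1) ?normr1//; lra.
split=> [[_ ne]|[j oj /(E _ oj)] h].
  apply: contrapT => /forall2NP h; apply: ne; apply/ffunP => j; apply: val_inj.
  rewrite /= cell_ofE//; apply/gindex_eq => [|oj]; first exact: cx.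
  by have [//|h'] := h j; apply: contrapT => /(E _ oj).
split=> // cE; apply: h; have /gindex_eq := cx j; rewrite -(cell_ofE _ xb) cE.
by case=> /(_ erefl oj).
Qed.

(** Rescaling its odd coordinates identifies a cell with the cube of dimension [dimc c]; its even
    coordinates are fixed. *)
Lemma extendable_cell (S : topologicalType) (c : cell) (X : set S) :
  fillable R (dimc c) X -> extendable (ecell c) (bcell c) X.
Proof.
have N0 : N%:R != 0 :> R by rewrite pnatr_eq0 -lt0n.
pose J := [pred j | odd (c j)].
(* [s y] places the coordinates of [y] in the odd directions and 0 in the even ones. *)
pose s (y : 'rV[R]_(dimc c)) j :=
  \sum_(k < dimc c) y ord0 k * (enum_val (A := J) k == j)%:R.
have sE y k : s y (enum_val (A := J) k) = y ord0 k.
  rewrite /s (bigD1 k)//= eqxx mulr1 big1 ?addr0// => k' kk'.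
  by rewrite (inj_eq enum_val_inj) (negbTE kk') mulr0.
have s0 y j : ~~ odd (c j) -> s y j = 0.
  move=> oj; rewrite /s big1// => k _; case: eqP => [kj|_]; last by rewrite mulr0.
  by have := enum_valP k; rewrite kj inE (negbTE oj).
have JE j : odd (c j) -> exists k, enum_val (A := J) k = j.
  by move=> oj; exists (enum_rank_in (A := J) oj j); rewrite enum_rankK_in.
pose phi (y : 'rV[R]_(dimc c)) : 'rV[R]_d :=
  \row_j (2 * (cell_mid c j + s y j / 2) / N%:R - 1).
pose psi (x : 'rV[R]_d) : 'rV[R]_(dimc c) :=
  \row_k (2 * (gscale (x ord0 (enum_val (A := J) k)) -
               cell_mid c (enum_val (A := J) k))).
have phiE y j : 2 * (gscale (phi y ord0 j) - cell_mid c j) = s y j.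
  by rewrite mxE /gscale; field.
have psi_le x : ecell c x -> cball (psi x).
  move=> cx; apply/rV_norm_le => // k; rewrite mxE.
  have /gscale_midP/le_trans := cx (enum_val (A := J) k); apply.
  by rewrite lern1 leq_b1.
have phi_ecell y : cball y -> ecell c (phi y).
  move=> /rV_norm_le -/(_ ler01) yb j; apply/gscale_midP; rewrite phiE.
  have [oj|ej] := boolP (odd (c j)); last by rewrite s0// normr0.
  by have [k <-] := JE j oj; rewrite sE.
apply: (@extendable_transfer _ _ _ _ _ _ _ _ phi psi).
- apply: cts_on_row => j.
  apply: (@cts_on_eq _ _ _
    (fun y => 2 * (cell_mid c j + s y j / 2) / N%:R - 1 : R^o)).
    by move=> y _; rewrite mxE.
  apply: (@cts_onB _ _ _ R^o); last exact: cts_on_cst.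
  apply: cts_onM; last exact: cts_on_cst.
  apply: cts_onM; first exact: cts_on_cst.
  apply: (@cts_onD _ _ _ R^o); first exact: cts_on_cst.
  apply: cts_onM; last exact: cts_on_cst.
  apply: (@cts_on_sum _ _ _ _ 
    (fun (k : 'I_(dimc c)) (y : 'rV[R]_(dimc c)) =>
       y ord0 k * (enum_val (A := J) k == j)%:R : R^o)) => k.
  apply: cts_onM; last exact: cts_on_cst.
  exact: (@cts_on_coord _ _ _ _ id) (@cts_on_id _ _ _).
- move=> y y1; have yb := csphere_cball y1.
  apply/bcellP; first exact: phi_ecell.
  have [k kE] : exists k, `|y| = `|y ord0 k|.
    by apply: rV_norm_coord; rewrite -normr_gt0 y1.
  exists (enum_val (A := J) k); first exact: enum_valP k.
  by rewrite phiE sE -kE.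
- apply: cts_on_row => k.
  apply: (@cts_on_eq _ _ _ (fun x : 'rV[R]_d => 2 *
     (gscale (x ord0 (enum_val (A := J) k)) - cell_mid c (enum_val (A := J) k)) : R^o)).
    by move=> y _; rewrite mxE.
  apply: cts_onM; first exact: cts_on_cst.
  apply: (@cts_onB _ _ _ R^o); last exact: cts_on_cst.
  apply: cts_on_gscale.
  exact: (@cts_on_coord _ _ _ _ id) (@cts_on_id _ _ _).
- exact: psi_le.
- move=> x bx; have cx := bx.1; have := psi_le _ cx.
  rewrite /cball /csphere /= => p1; apply/le_anti; rewrite p1 /=.
  have /bcellP -/(_ cx)[j oj <-] := bx; have [k <-] := JE j oj.
  by have := (rV_norm_le (psi x) (normr_ge0 _)).1 (lexx _) k; rewrite mxE.
- move=> x [cx _]; apply/rowP => j.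
  suff : gscale (phi (psi x) ord0 j) = gscale (x ord0 j).
    rewrite /gscale => /(congr1 (fun z => z * 2 / N%:R)).
    rewrite !mulfVK ?pnatr_eq0// ![N%:R * _]mulrC !mulfK//; lra.
  suff : s (psi x) j = 2 * (gscale (x ord0 j) - cell_mid c j).
    rewrite -phiE; lra.
  have [oj|ej] := boolP (odd (c j)); first by have [k <-] := JE j oj; rewrite sE mxE.
  have /gscale_midP := cx j; rewrite (negbTE ej) normr_le0 => /eqP ->.
  exact: s0.
Qed.

(** Proceed skeleton by skeleton, keeping [h0] on the subcomplex [P]. The boundary of any other cell
    already has its values in the carrier of that cell, because carriers grow from face to cell;
    fillability of the carrier then extends the map inside. *)
Lemma carrier_extension (S : topologicalType) (P : cell -> Prop)
    (h0 : 'rV[R]_d -> S) (X : cell -> set S) :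
  (forall c' c, face c' c -> P c -> P c') ->
  (forall c, P c -> cts_on (ecell c) h0) ->
  (forall c' c, ~ P c -> face c' c -> P c' ->
     forall x, ecell c' x -> X c (h0 x)) ->
  (forall c' c, ~ P c -> face c' c -> ~ P c' -> X c' `<=` X c) ->
  (forall c, ~ P c -> fillable R (dimc c) (X c)) ->
  exists h, [/\ cts_on (@cball R d) h,
    forall c x, P c -> ecell c x -> h x = h0 x &
    forall c x, ~ P c -> ecell c x -> X c (h x)].
Proof.
move=> Pface Ph0 XP XnP Xfill.
pose good h c := [/\ cts_on (ecell c) h,
    P c -> forall x, ecell c x -> h x = h0 x &
    ~ P c -> forall x, ecell c x -> X c (h x)].
(* Cells have dimension at most [d], so stage [d.+1] has treated all of them. *)
suff [h hP] : exists h, forall c, P c \/ (dimc c < d.+1)%N -> good h c.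
  have hgood c : good h c.
    by apply: hP; right; rewrite ltnS -[d in (_ <= d)%N]card_ord max_card.
  exists h; split; last 2 first.
  - by move=> c x Pc; have [_ /(_ Pc) + _] := hgood c; apply.
  - by move=> c x Pc; have [_ _ /(_ Pc)] := hgood c; apply.
  apply: cts_onS (closed_cts_on_finite_bigcup (P := fun=> True) closed_ecell _).
    by move=> x xb; exists (cell_of x) => //; exact: ecell_cell_of.
  by move=> c _; have [] := hgood c.
elim: d.+1 => [|k [h hP]].
  by exists h0 => c [Pc|//]; split=> //; exact: Ph0.
have /choice[G GP] : forall c, exists g, ~ P c -> dimc c = k ->
    [/\ cts_on (ecell c) g, forall x, ecell c x -> X c (g x) &
        forall x, bcell c x -> g x = h x].
  move=> c; have [Pc|nPc] := pselect (P c); first by exists h.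
  have [ck|ck] := eqVneq (dimc c) k; last by exists h => _ /eqP; rewrite (negbTE ck).
  have bP x : bcell c x -> [/\ face (cell_of x) c, ecell (cell_of x) x &
      P (cell_of x) \/ (dimc (cell_of x) < k)%N].
    move=> [cx ne]; have xc := face_cell_of cx; split=> //.
      exact/ecell_cell_of/ecell_cball/cx.
    by right; rewrite -ck; exact: face_dim.
  have [||g [gc gX gh]] := extendable_cell (Xfill _ nPc) (f := h).
  - pose Q c' := [/\ face c' c, c' <> c & P c' \/ (dimc c' < k)%N].
    apply: cts_onS (closed_cts_on_finite_bigcup (P := Q) closed_ecell _).
      move=> x bx; have [h1 h2 h3] := bP x bx; exists (cell_of x) => //.
      by split=> //; case: bx.
    by move=> c' [_ _ /hP[]].
  - move=> x /bP[xc cx] /hP[_ h1 h2].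
    have [Px|nPx] := pselect (P (cell_of x)).
      by rewrite h1//; apply: (XP _ _ nPc xc Px).
    by apply: (XnP _ _ nPc xc nPx); exact: h2.
  by exists g => _ _; split.
(* A new value is used only at interior points of a k-cell outside [P]. Every cell through such a
   point has that k-cell as a face, so it is neither in [P] nor of smaller dimension, and earlier
   cells keep their values. *)
pose new x := `[< ~ P (cell_of x) /\ dimc (cell_of x) = k >].
pose h' x := if new x then G (cell_of x) x else h x.
have old c x : P c \/ (dimc c < k)%N -> ecell c x -> h' x = h x.
  move=> cP cx; rewrite /h' /new; case: asboolP => // -[nP dk].
  have xc := face_cell_of cx; case: cP => [/(Pface _ _ xc)//|ck].
  have [xE|xne] := pselect (cell_of x = c); first by move: ck; rewrite -xE dk ltnn.
  by have := face_dim xc xne; rewrite dk => /(ltn_trans ck); rewrite ltnn.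
exists h' => c cP; have [cP'|ncP] := pselect (P c \/ (dimc c < k)%N).
  have [h1 h2 h3] := hP c cP'; split.
  - by apply: cts_on_eq h1 => x cx; rewrite (old c).
  - by move=> Pc x cx; rewrite (old c)// h2.
  - by move=> Pc x cx; rewrite (old c)//; exact: h3.
have nPc : ~ P c by move=> Pc; apply: ncP; left.
have ck : dimc c = k.
  case: cP => // ck1; apply/eqP; rewrite eqn_leq -ltnS ck1 leqNgt.
  by apply/negP => ck; apply: ncP; right.
have [gc gX gh] := GP c nPc ck.
have h'E x : ecell c x -> h' x = G c x.
  move=> cx; have [xE|xne] := pselect (cell_of x = c).
    by rewrite /h' /new xE asboolT.
  rewrite gh//; apply: (old (cell_of x)).
    by right; rewrite -ck; exact: face_dim (face_cell_of cx) xne.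
  exact/ecell_cell_of/ecell_cball/cx.
split=> //.
  by apply: cts_on_eq gc => x cx; rewrite h'E.
by move=> _ x cx; rewrite h'E//; exact: gX.
Qed.

Lemma ecell_dist c x y : ecell c x -> ecell c y -> `|y - x| <= 2 / N%:R.
Proof.
have N0 : 0 < N%:R :> R by rewrite ltr0n.
move=> cx cy; apply/rV_norm_le => [|j]; first by rewrite divr_ge0// ler0n.
have /andP[h1 h2] := cx j; have /andP[h3 h4] := cy j.
have : `|gscale (y ord0 j) - gscale (x ord0 j)| <= 1.
  have : (uphalf (c j))%:R <= ((c j)./2)%:R + 1 :> R.
    by rewrite natr1 ler_nat; lia.
  by move=> ?; rewrite ler_norml; apply/andP; split; lra.
rewrite !mxE ler_pdivlMr//.
have -> : gscale (y ord0 j) - gscale (x ord0 j) =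
   (y ord0 j - x ord0 j) * N%:R / 2 by rewrite /gscale; lra.
by rewrite !normrM [`|2^-1|]ger0_norm ?invr_ge0// (ger0_norm (ltW N0)); lra.
Qed.

(** Some coordinate of [x] is 1 or -1, a grid point, so the whole cell of [x] shares that
    coordinate. *)
Lemma csphere_cell_of x : csphere x -> ecell (cell_of x) `<=` @csphere R d.
Proof.
move=> x1 y cy; have xb := csphere_cball x1; have cx := ecell_cell_of xb.
have N0 : 0 < N%:R :> R by rewrite ltr0n.
have [j jE] : exists j, `|x| = `|x ord0 j|.
  by apply: rV_norm_coord; rewrite -normr_gt0 x1.
have uE : gscale (x ord0 j) = 0 \/ gscale (x ord0 j) = N%:R.
  move: jE; rewrite x1 /gscale => /esym/eqP; rewrite eqr_norml => /andP[/orP[]/eqP-> _].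
    by right; lra.
  by left; lra.
have ej : ~~ odd (cell_of x j).
  rewrite cell_ofE// /gindex; case: uE => ->; first by rewrite truncn0 eqxx addn0 odd_double.
  by rewrite natrK eqxx addn0 odd_double.
have hk : uphalf (cell_of x j) = (cell_of x j)./2 by lia.
have xyE : y ord0 j = x ord0 j.
  have := cx j; have := cy j; rewrite hk => /andP[h1 h2] /andP[h3 h4].
  have : gscale (y ord0 j) = gscale (x ord0 j) by apply/le_anti; lra.
  rewrite /gscale => /(congr1 (fun z => z * 2 / N%:R)).
  by rewrite !mulfVK ?pnatr_eq0// ![N%:R * _]mulrC !mulfK ?gt_eqF//; lra.
have := ecell_cball cy; rewrite /cball /csphere /= => y1.
apply/le_anti; rewrite y1 /= -x1 jE -xyE.
exact: (rV_norm_le y (normr_ge0 _)).1 (lexx _) j.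
Qed.

End Grid.

(** * Gluing along an open cover *)

(** The near-covering form of compactness turns local radii into a single one. *)
Lemma lebesgue_number (R : realType) (T : normedModType R) (S : topologicalType)
    (K : set T) (f : T -> S) (U V : set S) :
  compact K -> cts_on K f -> open U -> open V ->
  (forall x, K x -> U (f x) \/ V (f x)) ->
  exists2 e : R, 0 < e & forall x, K x ->
    (forall y, K y -> `|y - x| < e -> U (f y)) \/
    (forall y, K y -> `|y - x| < e -> V (f y)).
Proof.
move=> /compact_near_coveringP Kc fc oU oV fUV.
pose Q (O : set S) (e : R) (x : T) := forall y, K y -> `|y - x| < e -> O (f y).
have QP (O : set S) x : open O -> K x -> O (f x) ->
    \forall x' \near x & e \near (0 : R)^'+, Q O e x'.
  move=> oO Kx Ox; have := fc x Kx O (open_nbhs_nbhs (conj oO Ox)).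
  rewrite /= nbhs_simpl /within /= => /nbhs_normP[r /= r0 rO].
  (* Halving leaves room: a point within r/2 of x' is within r of x. *)
  exists (ball x (r / 2), [set e : R | e < r / 2]).
    split; first by apply: nbhsx_ballx; rewrite divr_gt0.
    by apply: nbhs_right_lt; rewrite divr_gt0.
  move=> [x' e] [/= x'x er] y Ky yx'; apply: (rO y) => //=.
  move: x'x; rewrite -ball_normE /= => x'x.
  rewrite distrC in yx'; have := ler_distD x' x y; lra.
have : \forall e \near (0 : R)^'+, K `<=` [set x | Q U e x \/ Q V e x].
  apply: Kc => x Kx; case: (fUV x Kx) => fx.
    by apply: filterS (QP U x oU Kx fx) => -[x' e] /= ?; left.
  by apply: filterS (QP V x oV Kx fx) => -[x' e] /= ?; right.
move=> /(filterI (nbhs_right_gt (0 : R))) /filter_ex[e [/= e0 eK]].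
by exists e.
Qed.
Section Gluing.
Variable R : realType.

Lemma fine_grid d (S : topologicalType) (K : set 'rV[R]_d) (f : 'rV[R]_d -> S)
    (U V : set S) (r : R) :
  compact K -> cts_on K f -> open U -> open V ->
  (forall x, K x -> U (f x) \/ V (f x)) -> 0 < r ->
  exists N, [/\ (0 < N)%N, 2 / N%:R < r & forall c : cell d N,
    (forall y, K y -> ecell c y -> U (f y)) \/
    (forall y, K y -> ecell c y -> V (f y))].
Proof.
move=> Kc fc oU oV fUV r0.
have [e e0 eP] := lebesgue_number Kc fc oU oV fUV.
pose m := Num.min e r; have m0 : 0 < m by rewrite lt_min e0.
(* Cells have diameter at most 2/N, and N = floor(2/m) + 1 brings this below both [e] and [r]. *)
exists (Num.truncn (2 / m)).+1.
have small : 2 / (Num.truncn (2 / m)).+1%:R < m.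
  rewrite ltr_pdivrMr ?ltr0n// mulrC -ltr_pdivrMr//.
  have /truncn_itv/andP[] // : 0 <= 2 / m by rewrite divr_ge0// ltW.
split=> [//||c]; first by apply: lt_le_trans small _; rewrite ge_min lexx orbT.
have [[x [Kx cx]]|none] := pselect (exists x, K x /\ ecell c x); last first.
  by left=> y Ky cy; case: none; exists y.
have near y : ecell c y -> `|y - x| < e.
  move=> cy; apply: le_lt_trans (ecell_dist _ cx cy) _ => //.
  by apply: lt_le_trans small _; rewrite ge_min lexx.
by case: (eP x Kx) => h; [left|right] => y Ky cy; apply: h => //; exact: near.
Qed.

Lemma compact_cball d : compact (@cball R d).
Proof.
apply: bounded_closed_compact; last exact: closed_norm_le.
exists 1; split; first by rewrite num_real.
by move=> M M1 x /= x1; apply: le_trans x1 _; exact: ltW.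
Qed.

(* Van Kampen without base points: a filling in [X] is kept on the cells it
   maps into [U] and replaced by a map into [X `&` U `&` V] on the others. *)
Lemma fillable_open_piece (S : topologicalType) (X U V : set S) n :
  open U -> open V -> X `<=` U `|` V -> fillable R n X ->
  (forall k, (k <= n)%N -> fillable R k (X `&` U `&` V)) ->
  fillable R n (X `&` U).
Proof.
move=> oU oV XUV Xfill Ifill f fc fX.
have [|g [gc gX gf]] := Xfill f fc; first by move=> x /fX[].
have [|N [N0 _ NP]] := fine_grid (compact_cball (d := n)) gc oU oV _ ltr01.
  by move=> x /gX /XUV.
pose P (c : cell n N) := forall y, ecell c y -> U (g y).
have V_cell (c : cell n N) : ~ P c -> forall y, ecell c y -> V (g y).
  move=> nPc; have [h|h] := NP c => y cy; last exact: h (ecell_cball N0 cy) cy.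
  by case: nPc => z cz; exact: h (ecell_cball N0 cz) cz.
have [|||||h [hc hP hnP]] :=
  @carrier_extension R n N N0 S P g (fun=> X `&` U `&` V).
- by move=> c' c cc Pc y /(face_ecell cc) /Pc.
- by move=> c _; apply: cts_onS gc; exact: ecell_cball N0 _.
- move=> c' c nPc cc Pc' x c'x; split; last exact: V_cell (face_ecell cc c'x).
  by split; [exact/gX/(ecell_cball N0 c'x)|exact: Pc'].
- by move=> c' c _ _ _ y.
- by move=> c _; apply: Ifill; rewrite -[leqRHS]card_ord max_card.
exists h; split=> // x xb.
  have cx := ecell_cell_of N0 xb.
  have [Px|nPx] := pselect (P (cell_of N x)); last by case: (hnP _ _ nPx cx).
  by rewrite (hP _ _ Px cx); split; [exact: gX|exact: Px].
(* The cell of a boundary point lies in the boundary of the cube, where [g] is [f] and lands in [U];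
   hence it is in [P] and keeps its values. *)
have cx := ecell_cell_of N0 (csphere_cball xb).
rewrite (hP _ _ _ cx) ?gf// => y /(csphere_cell_of N0 xb) y1.
by rewrite gf//; case: (fX _ y1).
Qed.

(* The target of a cell in the collar of the sphere is read off the radial
   extension of the map; away from the sphere everything is pushed into [U]. *)
Lemma fillable_union (S : topologicalType) (X U V : set S) n :
  open U -> open V -> X `<=` U `|` V ->
  (forall k, (k <= n)%N -> fillable R k (X `&` U)) ->
  (forall k, (k <= n)%N -> fillable R k (X `&` V)) ->
  (forall k, (k < n)%N -> fillable R k (X `&` U `&` V)) ->
  fillable R n X.
Proof.
move=> oU oV XUV Ufill Vfill Ifill f fc fX.
pose K := [set x : 'rV[R]_n | 2^-1 <= `|x| <= 1].
have Kn0 x : K x -> x != 0.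
  by move=> /andP[x2 _]; rewrite -normr_gt0; apply: lt_le_trans x2; lra.
have Kcompact : compact K.
  apply: (@subclosed_compact _ K (@cball R n)).
  - have -> : K = [set x | 2^-1 <= `|x|] `&` [set x | `|x| <= 1].
      by apply/seteqP; split=> x /andP.
    by apply: closedI; [exact: closed_norm_ge|exact: closed_norm_le].
  - exact: compact_cball.
  - by move=> x /andP[].
pose e (x : 'rV[R]_n) := f (`|x|^-1 *: x).
have e_in x : K x -> csphere (`|x|^-1 *: x).
  by move=> /Kn0; exact: normalize_csphere.
have ec : cts_on K e by apply: (cts_on_comp e_in _ fc); exact: cts_on_normalize.
have ef x : csphere x -> e x = f x by rewrite /e => ->; rewrite invr1 scale1r.
have [||N [N0 N2 NP]] := fine_grid (r := 2^-1) Kcompact ec oU oV.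
- by move=> x /e_in /fX /XUV.
- by rewrite invr_gt0.
pose touch (c : cell n N) := exists2 x : 'rV[R]_n, ecell c x & `|x| = 1.
(* A mesh below 1/2 keeps every cell that touches the sphere inside the collar. *)
have touchK c : touch c -> ecell c `<=` K.
  move=> [x cx x1] y cy; have := ecell_cball N0 cy; rewrite /cball /K /= => -> .
  rewrite andbT; have := ecell_dist N0 cy cx; have := ler_normD (x - y) y.
  by rewrite subrK x1; lra.
pose a (c : cell n N) := touch c -> forall y, ecell c y -> U (e y).
pose b (c : cell n N) := ecell c `<=` K /\ forall y, ecell c y -> V (e y).
(* Two demands shape the carrier: [U] under [a] and [V] under [b], and both conditions pass to
   faces. The intersection is used only below dimension n, where it is assumed fillable; proper
   faces always lie there, so carriers still grow from face to cell. *)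
pose T c := if `[< a c >] then
    if `[< b c /\ (dimc c < n)%N >] then X `&` U `&` V else X `&` U
  else X `&` V.
have ab c : ~ a c -> b c.
  move=> /not_implyP[tc nU]; have cK := touchK _ tc; split=> // y cy.
  have [h|h] := NP c; last exact: h (cK _ cy) cy.
  by case: nU => z cz; exact: h (cK _ cz) cz.
have TX c : T c `<=` X.
  by move=> y; rewrite /T; case: ifP => _; [case: ifP => _|] => -[] // [].
have TI c y : X y -> (a c -> U y) -> (b c -> V y) -> T c y.
  move=> Xy aU bV; rewrite /T; case: asboolP => [/aU Uy|/ab/bV //].
  by case: asboolP => [[/bV]|].
pose P (c : cell n N) := ecell c `<=` @csphere R n.
have [|||||h [hc hP hnP]] := @carrier_extension R n N N0 S P f T.
- by move=> c' c cc Pc y /(face_ecell cc) /Pc.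
- by move=> c Pc; apply: cts_onS fc.
- move=> c' c nPc cc Pc' x c'x; have x1 := Pc' _ c'x.
  have cx := face_ecell cc c'x; rewrite -(ef _ x1).
  apply: TI => [|ac|[_ bc]]; last exact: bc.
    by rewrite ef//; exact: fX.
  by apply: ac => //; exists x.
- move=> c' c _ cc _; have [<-//|ne] := pselect (c' = c).
  have dc' : (dimc c' < n)%N.
    apply: leq_trans (face_dim cc ne) _.
    by rewrite -[leqRHS]card_ord max_card.
  move=> y Ty; have aU : a c' -> U y.
    by move: Ty; rewrite /T; case: asboolP => // _; case: ifP => _ [] // [].
  have bV : b c' -> V y.
    move: Ty; rewrite /T; case: asboolP => [_|_ []//].
    by case: asboolP => [_ [] //|] nb _ bc'; case: nb.
  apply: TI; first exact: TX Ty.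
    move=> ac; apply: aU => -[x c'x x1] z c'z.
    by apply: ac (face_ecell cc c'z); exists x => //; exact: face_ecell cc _ c'x.
  move=> [cK cV]; apply: bV; split=> z /(face_ecell cc); [exact: cK|exact: cV].
- have dn (c : cell n N) : (dimc c <= n)%N by rewrite -[leqRHS]card_ord max_card.
  move=> c _; rewrite /T; case: ifP => _; last exact: Vfill.
  by case: asboolP => [[_ /Ifill]|_] //; exact: Ufill.
exists h; split=> // x xb.
  have cx := ecell_cell_of N0 xb.
  have [Px|nPx] := pselect (P (cell_of N x)); last exact: TX (hnP _ _ nPx cx).
  by rewrite (hP _ _ Px cx); apply: fX; exact: Px.
have cx := ecell_cell_of N0 (csphere_cball xb).
by rewrite (hP _ _ _ cx)//; exact: csphere_cell_of.
Qed.

End Gluing.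
(** * Removing the open star of a face *)

Section Geometry.
Variables (R : realType) (V : finType).
Implicit Types (p q : 'rV[R]_#|V|) (s F : {set V}) (D : {set {set V}}).

Definition down_closed D := forall s (t : {set V}), s \in D -> t \subset s -> t \in D.

Definition coord p (v : V) : R := p ord0 (enum_rank v).
Definition simplex s p := [/\ forall v, 0 <= coord p v, \sum_v coord p v = 1 &
  forall v, v \notin s -> coord p v = 0].
Definition vertices p : {set V} := [set v | coord p v != 0]%SET.

Lemma simplexS s s' p : s \subset s' -> simplex s p -> simplex s' p.
Proof.
move=> ss' [p0 p1 ps]; split=> // v vs'; apply: ps.
by apply: contra vs'; exact: (fintype.subsetP ss').
Qed.

Lemma coord_le1 s p v : simplex s p -> coord p v <= 1.
Proof.
move=> [p0 <- _]; rewrite (bigD1 v)//= lerDl.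
by apply: sumr_ge0 => ? _; exact: p0.
Qed.

Lemma geom_realP D p : geom_real D p <-> simplex (vertices p) p /\ vertices p \in D.
Proof.
have sumE : \sum_j p ord0 j = \sum_v coord p v.
  by rewrite (reindex (@enum_rank V))//; exact/onW_bij/enum_rank_bij.
split=> [[p0 [p1 pD]]|[[p0 p1 _] pD]].
  split=> //; split=> [v||v]; [exact: p0|by rewrite -sumE|].
  by rewrite inE negbK => /eqP.
split; last by rewrite sumE.
by move=> j; rewrite -(enum_valK j); exact: p0.
Qed.

Lemma simplex_geom_real D s p : down_closed D -> s \in D -> simplex s p ->
  geom_real D p.
Proof.
move=> Ddown sD [p0 p1 ps]; apply/geom_realP; split.
  by split=> // v; rewrite inE negbK => /eqP.
apply: Ddown sD _; apply/fintype.subsetP => v; rewrite inE.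
by apply: contraNT => /ps ->.
Qed.

Lemma coordD p q v : coord (p + q) v = coord p v + coord q v.
Proof. by rewrite /coord mxE. Qed.

Lemma coordN p v : coord (- p) v = - coord p v.
Proof. by rewrite /coord mxE. Qed.

Lemma coordZ a p v : coord (a *: p) v = a * coord p v.
Proof. by rewrite /coord mxE. Qed.

Lemma convex_lt (t x y c : R) : 0 <= t <= 1 -> x < c -> y < c ->
  (1 - t) * x + t * y < c.
Proof.
move=> /andP[t0 t1] xc yc; have [->|t1'] := eqVneq t 1; first by lra.
have : 0 < (1 - t) * (c - x) by rewrite mulr_gt0// subr_gt0// lt_neqAle t1'.
have : 0 <= t * (c - y) by rewrite mulr_ge0// subr_ge0 ltW.
by nra.
Qed.

Lemma convex_gt (t x y c : R) : 0 <= t <= 1 -> c < x -> c < y ->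
  c < (1 - t) * x + t * y.
Proof.
move=> t01 xc yc; have := @convex_lt t (- x) (- y) (- c) t01.
by rewrite !ltrN2 => /(_ xc yc); lra.
Qed.

Lemma coord_convex t p q v :
  coord ((1 - t) *: p + t *: q) v = (1 - t) * coord p v + t * coord q v.
Proof. by rewrite coordD !coordZ. Qed.

Lemma simplex_convex s p q t : 0 <= t <= 1 -> simplex s p -> simplex s q ->
  simplex s ((1 - t) *: p + t *: q).
Proof.
move=> /andP[t0 t1] [p0 p1 ps] [q0 q1 qs]; split=> [v||v vs].
- by rewrite coord_convex addr_ge0// mulr_ge0// subr_ge0.
- under eq_bigr do rewrite coord_convex.
  by rewrite big_split/= -!mulr_sumr p1 q1 !mulr1 subrK.
- by rewrite coord_convex ps// qs// !mulr0 addr0.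
Qed.

Section Face.
Variable F : {set V}.
Hypothesis F0 : F != finset.set0.
Local Notation r := (#|F|%:R : R).

Let r_gt0 : 0 < r. Proof. by rewrite ltr0n card_gt0. Qed.

(** The height function behind the cover: on the realization it is positive exactly on the open star
    of [F] and reaches 1/|F| only at the barycenter. The default 1 is harmless because barycentric
    coordinates are at most 1. *)
Definition face_min p : R := \big[Num.min/1]_(v in F) coord p v.
Definition face_ind : 'rV[R]_#|V| := \row_j (enum_val j \in F)%:R.
Definition barycenter := r^-1 *: face_ind.
(* The radial projection away from the barycenter of [F]. *)
Definition radial p := (1 - r * face_min p)^-1 *: (p - face_min p *: face_ind).

Lemma coord_face_ind v : coord face_ind v = (v \in F)%:R.
Proof. by rewrite /coord mxE enum_rankK. Qed.

Lemma coord_barycenter v : coord barycenter v = r^-1 * (v \in F)%:R.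
Proof. by rewrite /barycenter coordZ coord_face_ind. Qed.

Lemma sum_face_ind : \sum_v (v \in F)%:R = r.
Proof.
rewrite -[RHS]sumr_const [RHS]big_mkcond; apply: eq_bigr => v _.
by case: (v \in F).
Qed.

Lemma simplex_barycenter : simplex F barycenter.
Proof.
split=> [v||v vF].
- by rewrite coord_barycenter mulr_ge0// invr_ge0 ltW.
- under eq_bigr do rewrite coord_barycenter.
  by rewrite -mulr_sumr sum_face_ind mulVf// gt_eqF.
- by rewrite coord_barycenter (negbTE vF) mulr0.
Qed.

Lemma face_min_le p v : v \in F -> face_min p <= coord p v.
Proof. by move=> vF; exact: bigmin_le_cond. Qed.

Lemma face_min_gt0 p : (forall v, v \in F -> 0 < coord p v) -> 0 < face_min p.
Proof. by move=> h; apply: lt_bigmin. Qed.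

Lemma face_min_ge0 s p : simplex s p -> 0 <= face_min p.
Proof. by move=> [p0 _ _]; apply: le_bigmin => // v _; exact: p0. Qed.

Lemma face_min_attained s p : simplex s p ->
  exists2 v, v \in F & face_min p = coord p v.
Proof.
move=> ps; have [v0 v0F] := set0Pn _ F0.
have [v vF mE] := eq_bigmin (x := 1) v0 (mem F) (coord p) v0F
  (fun v _ => coord_le1 v ps).
by exists v.
Qed.

Lemma face_min_sub s p : simplex s p -> 0 < face_min p -> F \subset s.
Proof.
move=> [_ _ ps] m0; apply/fintype.subsetP => v vF; apply: contraTT m0.
by move=> /ps vE; rewrite -leNgt -vE face_min_le.
Qed.

Lemma continuous_face_min : continuous (face_min : _ -> R^o).
Proof.
rewrite /face_min.
apply: continuous_cts_onT; elim: (index_enum V) => [|v l IHl].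
  apply: (@cts_on_eq _ _ _ (fun=> 1 : R^o)); last exact: cts_on_cst.
  by move=> p _; rewrite big_nil.
have [vF|vF] := boolP (v \in F); last first.
  by apply: cts_on_eq IHl => p _; rewrite big_cons (negbTE vF).
apply: (@cts_on_eq _ _ _ (coord^~ v \min
    (fun p => \big[Num.min/1]_(j <- l | j \in F) coord p j))).
  by move=> p _; rewrite big_cons vF.
apply: cts_on_continuous => p; apply: continuous_min.
  exact: coord_continuous.
exact: continuous_cts_onT IHl p.
Qed.

Lemma open_face_min_lt : open [set p | face_min p < r^-1].
Proof.
apply: (@open_comp _ _ _ [set y : R | y < r^-1]); last exact: open_lt.
by move=> p _; exact: continuous_face_min.
Qed.

Lemma open_face_min_gt : open [set p | 0 < face_min p].
Proof.
apply: (@open_comp _ _ _ [set y : R | 0 < y]); last exact: open_gt.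
by move=> p _; exact: continuous_face_min.
Qed.

Lemma face_min_denom p : face_min p < r^-1 -> 0 < 1 - r * face_min p.
Proof. by move=> ?; rewrite subr_gt0 -ltr_pdivlMl// mulr1. Qed.

Lemma coord_radial p v : coord (radial p) v =
  (1 - r * face_min p)^-1 * (coord p v - face_min p * (v \in F)%:R).
Proof. by rewrite /radial coordZ coordD coordN coordZ coord_face_ind. Qed.

(** Subtracting the minimum kills a minimal coordinate on [F] and leaves total mass
    [1 - r * face_min p], which is the normalizing factor. If [F] is not inside [s], the minimum is
    0 and [p] is fixed. *)
Lemma simplex_radial s p : simplex s p -> face_min p < r^-1 ->
  simplex s (radial p) /\ exists2 v, v \in F & coord (radial p) v = 0.
Proof.
move=> ps /face_min_denom d0; have m0 := face_min_ge0 ps.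
have [p0 p1 poff] := ps.
split; last first.
  have [v vF mE] := face_min_attained ps; exists v => //.
  by rewrite coord_radial vF mulr1 mE subrr mulr0.
split=> [v||v vs].
- rewrite coord_radial mulr_ge0 ?invr_ge0 ?(ltW d0)// subr_ge0.
  by have [vF|_] := boolP (v \in F); rewrite ?mulr1 ?mulr0// face_min_le.
- under eq_bigr do rewrite coord_radial.
  rewrite -mulr_sumr sumrB p1 -mulr_sumr sum_face_ind [_ * r]mulrC mulVf//.
  by rewrite gt_eqF.
- rewrite coord_radial poff//; have [vF|_] := boolP (v \in F).
    have m_le := face_min_le p vF; rewrite poff// in m_le.
    by rewrite (_ : face_min p = 0) ?mul0r ?subr0 ?mulr0//; apply/le_anti/andP.
  by rewrite mulr0 subr0 mulr0.
Qed.

Lemma cts_on_radial : cts_on [set p | face_min p < r^-1] radial.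
Proof.
have mc A : cts_on A (face_min : _ -> R^o).
  exact/cts_on_continuous/continuous_face_min.
apply: (@cts_onZ _ _ _ _ (fun p => (1 - r * face_min p)^-1)).
  apply: cts_onV => [p /= /face_min_denom /lt0r_neq0//|].
  apply: (@cts_onB _ _ _ R^o); first exact: cts_on_cst.
  by apply: cts_onM => //; exact: cts_on_cst.
apply: cts_onB; first exact: cts_on_id.
by apply: (@cts_onZ _ _ _ _ face_min) => //; exact: cts_on_cst.
Qed.

Variable D : {set {set V}}.
Hypotheses (Ddown : down_closed D) (FD : F \in D).

Definition deletion : {set {set V}} := [set s in D | ~~ (F \subset s)]%SET.
(* The link of the barycenter of [F] in the stellar subdivision of [D] at [F]. *)
Definition sphere_link : {set {set V}} :=
  [set s in D | ~~ (F \subset s) && (s :|: F \in D)]%SET.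

Let X := geom_real (R := R) D.
Let Ulow := [set p | face_min p < r^-1].
Let Uhigh := [set p | 0 < face_min p].

Lemma face_min_cover : X `<=` Ulow `|` Uhigh.
Proof.
move=> p _; case: (ltP (face_min p) r^-1) => [|h]; first by left.
by right; apply: lt_le_trans h; rewrite invr_gt0.
Qed.

Lemma deletion_down : down_closed deletion.
Proof.
move=> s t; rewrite !inE => /andP[sD Fs] ts; rewrite (Ddown sD ts) /=.
by apply: contra Fs => /fintype.subset_trans; apply.
Qed.

Lemma geom_real_deletion p : geom_real deletion p ->
  X p /\ exists2 v, v \in F & coord p v = 0.
Proof.
move=> /geom_realP[ps]; rewrite inE => /andP[pD].
move=> /fintype.subsetPn[v vF]; rewrite inE negbK => /eqP pv.
by split; [exact/geom_realP|exists v].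
Qed.

Lemma radial_deletion p : X p -> Ulow p -> geom_real deletion (radial p).
Proof.
move=> /geom_realP[ps pD] pm; have [rs [v vF rv]] := simplex_radial ps pm.
apply/geom_realP; split; first by split; case: rs => // ? ? _ u;
  rewrite inE negbK => /eqP.
have rp : vertices (radial p) \subset vertices p.
  apply/fintype.subsetP => u; rewrite [in X in X -> _]inE.
  by apply: contraNT; case: rs => _ _ + h; move=> ->.
rewrite inE (Ddown pD rp) /=; apply/fintype.subsetPn; exists v => //.
by rewrite inE rv eqxx.
Qed.

(** The open star is star-shaped about the barycenter of [F]. *)
Lemma fillable_star n : fillable R n (X `&` Uhigh).
Proof.
have bX : (X `&` Uhigh) barycenter.
  split; first exact: simplex_geom_real FD simplex_barycenter.
  apply: face_min_gt0 => v vF; rewrite coord_barycenter vF mulr1.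
  by rewrite invr_gt0.
apply: (@fillable_dominated _ _ _ _ [set barycenter] (fun=> barycenter) id);
  last exact: fillable_set1.
- exact: cts_on_cst.
- by [].
- exact: cts_on_id.
- move=> p [/geom_realP[ps pD] pm] t t01; split.
    apply: (simplex_geom_real Ddown pD); apply: simplex_convex => //.
    exact: simplexS (face_min_sub ps pm) simplex_barycenter.
  apply: face_min_gt0 => v vF; rewrite coord_convex coord_barycenter vF mulr1.
  apply: convex_gt => //; first exact: lt_le_trans pm (face_min_le p vF).
  by rewrite invr_gt0.
- by move=> _ ->.
Qed.

(** Sliding [p] to [radial p] stays off the barycenter: a coordinate minimal on [F] only decreases,
    down to 0. *)
Lemma fillable_lower n : fillable R n (geom_real (R := R) deletion) ->
  fillable R n (X `&` Ulow).
Proof.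
apply: (@fillable_dominated _ _ _ _ _ radial id).
- by apply: cts_onS cts_on_radial => p [].
- by move=> p []; exact: radial_deletion.
- exact: cts_on_id.
- move=> p [/geom_realP[ps pD] pm] t t01; have [rs _] := simplex_radial ps pm.
  split; first by apply: (simplex_geom_real Ddown pD); exact: simplex_convex.
  have [v vF mE] := face_min_attained ps.
  apply: le_lt_trans (face_min_le _ vF) _; apply: le_lt_trans pm.
  rewrite coord_convex coord_radial vF mulr1 -mE subrr mulr0 mulr0 addr0.
  by have := face_min_ge0 ps; case/andP: t01 => *; nra.
- move=> p /geom_real_deletion[Xp [v vF pv]]; split=> //.
  by apply: le_lt_trans (face_min_le _ vF) _; rewrite pv invr_gt0.
Qed.

(** [radial] is the identity on the deletion, which is thus a retract, and the segments required are
    constant. *)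
Lemma fillable_deletion n : fillable R n (X `&` Ulow) ->
  fillable R n (geom_real (R := R) deletion).
Proof.
have radialK p : geom_real deletion p -> radial p = p /\ Ulow p.
  move=> /geom_real_deletion[/geom_realP[ps _] [v vF pv]].
  have m0 : face_min p = 0.
    apply/le_anti; rewrite (face_min_ge0 ps) andbT -pv; exact: face_min_le.
  by rewrite /radial /Ulow /= m0 mulr0 subr0 invr1 scale1r scale0r subr0 invr_gt0.
apply: (@fillable_dominated _ _ _ _ _ id radial).
- exact: cts_on_id.
- by move=> p pD; have [Xp _] := geom_real_deletion pD; have [] := radialK p pD.
- by apply: cts_onS cts_on_radial => p [].
- move=> p pD t _; have [-> _] := radialK p pD.
  by rewrite -scalerDl subrK scale1r.
- by move=> p []; exact: radial_deletion.
Qed.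

(** Up to homotopy the punctured star is [sphere_link]: [radial] projects onto it, [back] returns,
    and a segment joins each point to its image under the round trip. *)
Lemma fillable_punctured_star n : fillable R n (geom_real (R := R) sphere_link) ->
  fillable R n (X `&` Ulow `&` Uhigh).
Proof.
have r1 : 0 < r^-1 by rewrite invr_gt0.
(* Halfway to the barycenter, each coordinate on [F] is at least 1/(2r), with equality where [q]
   vanishes; so the point lies in both open sets. *)
pose back q : 'rV[R]_#|V| := (1 - 2^-1) *: q + 2^-1 *: barycenter.
have half01 : 0 <= (2^-1 : R) <= 1 by lra.
have backE q v : v \in F -> coord (back q) v = (coord q v + r^-1) / 2.
  by move=> vF; rewrite coord_convex coord_barycenter vF mulr1; lra.
apply: (@fillable_dominated _ _ _ _ _ radial back).
- by apply: cts_onS cts_on_radial => p [[]].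
- move=> p [[Xp pm] pm0]; have /geom_realP[rs] := radial_deletion Xp pm.
  rewrite inE => /andP[rD Fr]; apply/geom_realP; split=> //.
  rewrite inE rD Fr /=; have /geom_realP[ps pD] := Xp.
  apply: (Ddown pD); rewrite finset.subUset (face_min_sub ps pm0) andbT.
  have [[_ _ h] _] := simplex_radial ps pm.
  apply/fintype.subsetP => u; rewrite [in X in X -> _]inE.
  by apply: contraNT => /h ->.
- apply: cts_onD; apply: (@cts_onZ _ _ _ _ (fun=> _));
    by [exact: cts_on_cst|exact: cts_on_id].
- move=> p [[/geom_realP[ps pD] pm] pm0] t t01; have Fp := face_min_sub ps pm0.
  have [rs _] := simplex_radial ps pm.
  have bs := simplex_convex half01 rs (simplexS Fp simplex_barycenter).
  have rad0 v : 0 <= coord (radial p) v by case: rs.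
  split; first split.
  + by apply: (simplex_geom_real Ddown pD); exact: simplex_convex.
  + have [v vF mE] := face_min_attained ps.
    apply: le_lt_trans (face_min_le _ vF) _.
    rewrite coord_convex backE// coord_radial vF mulr1 -mE subrr mulr0 add0r.
    by apply: convex_lt => //; lra.
  + apply: face_min_gt0 => v vF; rewrite coord_convex backE//.
    apply: convex_gt => //; first exact: lt_le_trans pm0 (face_min_le p vF).
    by have := rad0 v; lra.
- move=> q /geom_realP[qs]; rewrite inE => /and3P[qD Fq qF].
  have [q0 _ _] := qs.
  split; first split.
  + apply: (simplex_geom_real Ddown qF); apply: simplex_convex => //.
      by apply: simplexS qs; exact: finset.subsetUl.
    by apply: simplexS simplex_barycenter; exact: finset.subsetUr.
  + move/fintype.subsetPn: Fq => [v vF]; rewrite inE negbK => /eqP qv.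
    by apply: le_lt_trans (face_min_le _ vF) _; rewrite backE// qv; lra.
  + by apply: face_min_gt0 => v vF; rewrite backE//; have := q0 v; lra.
Qed.

End Face.
End Geometry.
(** * Joins with the boundary of a simplex *)

Section Join.
Variables (R : realType) (V : finType).
Implicit Types (s F : {set V}) (v w : V).

(* [nfillable p X] encodes conn(X) >= p - 2. *)
Definition nfillable p (X : set 'rV[R]_#|V|) :=
  forall n, (n < p)%N -> fillable R n X.

Lemma set1_neq0 v : [set v]%SET != finset.set0.
Proof. by apply/finset.set0Pn; exists v; rewrite inE. Qed.

(** A cone is star-shaped about its apex, written here as the barycenter of [[set w]]. *)
Lemma fillable_cone (D : {set {set V}}) w n : down_closed D ->
  finset.set0 \in D -> (forall s, s \in D -> w |: s \in D) ->
  fillable R n (geom_real (R := R) D).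
Proof.
move=> Ddown D0 Dw; pose e := @barycenter R V [set w]%SET.
have es : simplex [set w]%SET e by apply: simplex_barycenter; exact: set1_neq0.
apply: (@fillable_dominated _ _ _ _ [set e] (fun=> e) id);
  last exact: fillable_set1.
- exact: cts_on_cst.
- by [].
- exact: cts_on_id.
- move=> p /geom_realP[ps pD] t t01.
  apply: (simplex_geom_real Ddown (Dw _ pD)); apply: simplex_convex => //.
    by apply: simplexS ps; exact: finset.subsetUr.
  by apply: simplexS es; exact: finset.subsetUl.
- move=> _ ->; apply: (simplex_geom_real Ddown (Dw _ D0)).
  by rewrite finset.setU0.
Qed.

(* The join of the boundary of the simplex [F] with [L]. *)
Definition boundary_join F (L : {set {set V}}) : {set {set V}} :=
  [set s | (s :\: F \in L) && ~~ (F \subset s)]%SET.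

Lemma boundary_join_down F L : down_closed L -> down_closed (boundary_join F L).
Proof.
move=> Ldown s t; rewrite !inE => /andP[sL Fs] ts.
rewrite (Ldown _ _ sL) ?finset.setSD//=.
by apply: contra Fs => /fintype.subset_trans; apply.
Qed.

(* The boundary of [F] is the union of two cones, over the star and the
   complement of a vertex, so it suspends [L] once per extra vertex of [F]. *)
Lemma nfillable_boundary_join p F (L : {set {set V}}) :
  down_closed L -> finset.set0 \in L -> (forall s, s \in L -> [disjoint s & F]%B) ->
  F != finset.set0 -> nfillable p (geom_real (R := R) L) ->
  nfillable (p + #|F|.-1) (geom_real (R := R) (boundary_join F L)).
Proof.
move=> Ldown L0 LF F0 Lfill; have : #|F| = (#|F|.-1).+1 by rewrite prednK// card_gt0.
move: (#|F|.-1) => k; elim: k F F0 LF => [|k IHk] F F0 LF cF.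
  (* A single vertex has boundary {∅}, so the join is [L] itself. *)
  rewrite addn0; have /eqP/finset.cards1P[v vE] := cF.
  suff -> : boundary_join F L = L by [].
  apply/setP => s; rewrite inE vE finset.sub1set; apply/andP/idP => [[sL vs]|sL].
    by rewrite (finset.setDidPl _) // disjoint_sym finset.disjoints1 in sL.
  have := LF _ sL; rewrite vE disjoint_sym finset.disjoints1 => vs; split=> //.
  by apply: (Ldown _ _ sL); exact: finset.subsetDl.
have [v vF] := finset.set0Pn _ F0.
have cF' : #|F :\ v| = k.+1 by move: cF; rewrite (cardsD1 v) vF => -[].
have F'0 : F :\ v != finset.set0 by rewrite -card_gt0 cF'.
(* A second vertex of [F] serves as the apex of the deletion of [v]: while [v] is missing, adding
   [w] cannot complete [F]. *)
have [w wF'] := finset.set0Pn _ F'0; have /finset.setD1P[wv wF] := wF'.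
have LF' s : s \in L -> [disjoint s & F :\ v]%B.
  by move=> /LF; apply: disjointWr; exact: finset.subsetDl.
have Jdown := boundary_join_down (F := F) Ldown.
have v0 := set1_neq0 v.
have vJ : [set v]%SET \in boundary_join F L.
  rewrite inE; apply/andP; split.
    suff -> : [set v]%SET :\: F = finset.set0 by [].
    by apply/eqP; rewrite finset.setD_eq0 finset.sub1set.
  by apply/negP => /subset_leq_card; rewrite cF cards1.
have linkE : sphere_link [set v]%SET (boundary_join F L) = boundary_join (F :\ v) L.
  apply/setP => s; rewrite !inE finset.sub1set.
  have sE : (s :|: [set v]%SET) :\: F = s :\: F.
    rewrite finset.setDUl (_ : [set v]%SET :\: F = finset.set0) ?finset.setU0//.
    by apply/eqP; rewrite finset.setD_eq0 finset.sub1set.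
  have FE : (F \subset s :|: [set v]%SET) = (F :\ v \subset s).
    by rewrite finset.subDset finset.setUC.
  rewrite sE FE; have [vs|vs] := boolP (v \in s); rewrite ?andbF /=.
    apply/esym/negbTE/negP => /andP[/LF/pred0P/(_ v)].
    by rewrite /= !inE vs vF eqxx.
  have -> : s :\: (F :\ v) = s :\: F.
    apply/setP => u; rewrite !inE; case: eqP => [->|//].
    by rewrite (negbTE vs) !andbF.
  case: (s :\: F \in L) => //=; apply/andP/idP => [[]//|h]; split=> //.
  by apply: contra h => /(fintype.subset_trans (finset.subD1set F v)).
move=> n np.
apply: (fillable_union (@open_face_min_lt R V [set v]%SET)
    (@open_face_min_gt R V [set v]%SET)).
- exact: face_min_cover.
- move=> m _; apply: fillable_lower => //.
  apply: (@fillable_cone _ w); first exact: deletion_down.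
    rewrite inE (Jdown _ _ vJ) ?finset.sub0set//= finset.sub1set inE//.
  move=> s; rewrite !inE !finset.sub1set !inE => /andP[/andP[sL Fs] vs].
  rewrite eq_sym (negbTE wv) (negbTE vs) /= andbT; apply/andP; split.
    rewrite (_ : (w |: s) :\: F = s :\: F)//.
    rewrite finset.setDUl (_ : [set w]%SET :\: F = finset.set0) ?finset.set0U//.
    by apply/eqP; rewrite finset.setD_eq0 finset.sub1set.
  apply/fintype.subsetPn; exists v => //.
  by rewrite !inE eq_sym (negbTE wv) (negbTE vs).
- by move=> m _; exact: fillable_star.
(* The gluing asks for the intersection only in dimensions m < n; this is the degree gained with
   each extra vertex. *)
- move=> m mn; apply: fillable_punctured_star => //.
  by rewrite linkE; apply: IHk => //; lia.
Qed.

End Join.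
(** * Independence complexes *)

Section Hypergraph.
Variables (R : realType) (V : finType).
Implicit Types (s W F E G : {set V}) (C : {set {set V}}).

(** [Ind] ranges over the ambient type while the recursion shrinks the vertex set; the restriction
    to [W] prevents removed vertices from reappearing as isolated ones. *)
Definition IndOn W C : {set {set V}} := [set s in Ind C | s \subset W]%SET.

Lemma in_IndOn W C s :
  reflect ((forall E, E \in C -> ~~ (E \subset s)) /\ s \subset W) (s \in IndOn W C).
Proof.
rewrite !inE; apply: (iffP andP) => -[h sW]; split=> //.
  by move=> E EC; move/forallP: h => /(_ E) /implyP /(_ EC).
by apply/forallP => E; apply/implyP => /h.
Qed.

Lemma IndOn_down W C : down_closed (IndOn W C).
Proof.
move=> s t /in_IndOn[h sW] ts; apply/in_IndOn; split.
  by move=> E /h; apply: contra => Et; exact: fintype.subset_trans ts.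
exact: fintype.subset_trans sW.
Qed.

Lemma deletion_IndOn W C F : F \in C -> deletion F (IndOn W (C :\ F)) = IndOn W C.
Proof.
move=> FC; apply/setP => s; rewrite [LHS]inE; apply/andP/in_IndOn.
  move=> [/in_IndOn[h sW] Fs]; split=> // E EC.
  by have [->//|EF] := eqVneq E F; apply: h; rewrite !inE EF.
move=> [h sW]; split; last exact: h.
by apply/in_IndOn; split=> // E /finset.setD1P[_ /h].
Qed.

Variables (W : {set V}) (C : {set {set V}}).
Hypothesis hypC : is_hypergraph W C.

Lemma is_hypergraph_delete F : is_hypergraph W (C :\ F).
Proof.
have [h1 [h2 h3]] := hypC; split; first by move=> E /finset.setD1P[_ /h1].
split; first by move=> E /finset.setD1P[_ /h2].
by move=> E E' /finset.setD1P[_ EC] /finset.setD1P[_ E'C]; exact: h3.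
Qed.

Variable F : {set V}.
Hypothesis FC : F \in C.

Let D : {set {set V}} := [set E :\: F | E in C :\ F]%SET.

Lemma colon_edgesP G : G \in colon_edges C F <->
  [/\ G \in D, forall G', G' \in D -> G' \subset G -> G' = G & (1 < #|G|)%N].
Proof.
rewrite inE -/D; split.
  move=> /and3P[GD /forallP h G1]; split=> // G' G'D G'G.
  by move: (h G'); rewrite G'D G'G => /eqP.
move=> [GD h G1]; rewrite GD G1 andbT /=; apply/forallP => G'.
by apply/implyP => G'D; apply/implyP => /(h _ G'D) ->.
Qed.

(** Singleton traces are dropped from [colon_edges] by the size condition; deleting their vertices
    from the vertex set accounts for them. *)
Lemma hnbhdP v : v \in hnbhd C F <-> [set v]%SET \in D.
Proof.
split.
  move=> /bigcupP[E /andP[EC /cards1P[u uE]]]; rewrite uE inE => /eqP ->.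
  apply/imsetP; exists E => //; rewrite !inE EC andbT.
  by apply/eqP => EF; move/setP: uE => /(_ u); rewrite EF !inE eqxx andNb.
move=> /imsetP[E /finset.setD1P[_ EC] vE]; apply/bigcupP; exists E.
  by rewrite EC -vE cards1.
by rewrite -vE inE.
Qed.

Lemma colon_vsP v : v \in colon_vs W C F <->
  [/\ v \in W, v \notin F & [set v]%SET \notin D].
Proof.
rewrite !inE negb_or; split.
  move=> /andP[/andP[vF vN] vW]; split=> //.
  by apply: contra vN => /hnbhdP.
move=> [-> -> vN]; rewrite !andbT /=.
by apply: contra vN => /hnbhdP.
Qed.

Lemma colon_member_sub G : G \in D -> G \subset W /\ [disjoint G & F]%B.
Proof.
move=> /imsetP[E /finset.setD1P[_ EC] ->]; split.
  exact: fintype.subset_trans (finset.subsetDl _ _) (hypC.1 _ EC).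
by rewrite disjoint_sym finset.disjoints_subset finset.setCD finset.subsetUr.
Qed.

Lemma is_hypergraph_colon : is_hypergraph (colon_vs W C F) (colon_edges C F).
Proof.
split; [|split] => [G /colon_edgesP[GD Gmin G1]|G /colon_edgesP[]//|].
  have [GW GF] := colon_member_sub GD; apply/fintype.subsetP => v vG.
  apply/colon_vsP; split; first exact: (fintype.subsetP GW).
    by rewrite (disjointFr GF).
  apply/negP => vD; have vGE := Gmin _ vD; move: G1; rewrite -vGE ?cards1//.
  by rewrite finset.sub1set.
by move=> G G' /colon_edgesP[GD _ _] /colon_edgesP[_ h _] /(h _ GD).
Qed.

(** [E] lies in [s :|: F] exactly when its trace [E :\: F] lies in [s]. Below every trace is a
    minimal one, which is either an edge of the colon or a singleton excluded by the vertex set. *)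
Lemma colon_IndOn s : [disjoint s & F]%B ->
  (s \in IndOn (colon_vs W C F) (colon_edges C F)) = (s :|: F \in IndOn W (C :\ F)).
Proof.
move=> sF; have [h1 [h2 h3]] := hypC.
have subE E : (E \subset s :|: F) = (E :\: F \subset s).
  by rewrite finset.subDset finset.setUC.
apply/in_IndOn/in_IndOn => -[sC sW]; split.
- move=> E ECF; rewrite subE; apply/negP => EFs.
  have ED : E :\: F \in D by apply/imsetP; exists E.
  (* A smallest trace below [E :\: F] is inclusion-minimal in all of [D], since whatever lies below
     it competes with it. *)
  pose P G := (G \in D) && (G \subset E :\: F).
  have [G /andP[GD GE] Gmin] : exists2 G, P G &
      forall G', P G' -> (#|G| <= #|G'|)%N.
    have PE : P (E :\: F) by rewrite /P ED fintype.subxx.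
    by exists [arg min_(G < E :\: F | P G) #|G|]; case: arg_minnP.
  have Gs : G \subset s := fintype.subset_trans GE EFs.
  (* An empty trace would put another edge inside [F], against incomparability. *)
  have [G0|[v vG]] := set_0Vmem G.
    move/imsetP: GD => [E' /finset.setD1P[E'F E'C] E'E].
    move/eqP: E'E; rewrite G0 eq_sym finset.setD_eq0 => E'sub.
    by move/eqP: E'F; apply; exact: h3.
  have [G1|G1] := ltnP 1 #|G|.
    have /sC/negP : G \in colon_edges C F.
      apply/colon_edgesP; split=> // G' G'D G'G.
      apply/eqP; rewrite eqEcard G'G; apply: Gmin.
      by rewrite /P G'D (fintype.subset_trans G'G GE).
    by apply.
  have /colon_vsP[_ _ /negP] := fintype.subsetP sW _ (fintype.subsetP Gs _ vG).
  apply; suff <- : G = [set v]%SET by [].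
  apply/esym/eqP; rewrite eqEcard finset.sub1set vG cards1.
  exact: G1.
- rewrite finset.subUset (h1 _ FC) andbT; apply/fintype.subsetP => v.
  by move=> /(fintype.subsetP sW)/colon_vsP[].
- move=> G /colon_edgesP[/imsetP[E ECF ->] _ _].
  by rewrite -subE; exact: sC.
- apply/fintype.subsetP => v vs; apply/colon_vsP; split.
  + by apply: (fintype.subsetP sW); rewrite inE vs.
  + by rewrite (disjointFr sF).
  + apply/negP => /imsetP[E ECF vE]; have /negP := sC _ ECF; apply.
    by rewrite subE -vE finset.sub1set.
Qed.

(** The condition on [s] involves only [s :|: F], which is unchanged when [F] is first removed from
    [s]; [colon_IndOn] then applies to [s :\: F]. *)
Lemma sphere_link_IndOn : sphere_link F (IndOn W (C :\ F)) =
  boundary_join F (IndOn (colon_vs W C F) (colon_edges C F)).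
Proof.
apply/setP => s; rewrite [LHS]inE [RHS]inE.
have sFE : (s :\: F) :|: F = s :|: F.
  rewrite finset.setDE finset.setUIl [X in _ :&: X]finset.setUC.
  by rewrite finset.setUCr finset.setIT.
rewrite colon_IndOn ?sFE; last first.
  by rewrite disjoint_sym finset.disjoints_subset finset.setCD finset.subsetUr.
rewrite andbC -andbA; case: (F \subset s); rewrite /= ?andbF ?andbT//.
apply/andP/idP => [[]//|h]; split=> //.
by apply: IndOn_down h _; exact: finset.subsetUl.
Qed.

End Hypergraph.

(** * The bound *)

Section Connectivity.
Variable R : realType.

Definition le_ext p (x : option nat) := if x is Some q then (p <= q)%N else true.

(** The alternative [p = 0] comes from the neutral element [Some 0] of the maximum. *)
Lemma le_ext_bigmax (I : finType) (P : pred I) (a : I -> option nat) p :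
  le_ext p (\big[emax/Some 0%N]_(i | P i) a i) ->
  p = 0%N \/ exists2 i, P i & le_ext p (a i).
Proof.
apply: (big_rec (fun x => le_ext p x -> _)) => [|i x Pi IHx].
  by rewrite /= leqn0 => /eqP; left.
have [pa _|npa] := boolP (le_ext p (a i)); first by right; exists i.
move=> pax; apply: IHx; move: pax npa; case: (a i) x => [b|] [x|] //=.
by rewrite leq_max => /orP[->|].
Qed.

(** Exhausted fuel returns 0, which demands nothing, so the bound holds by induction at every fuel.
    For an edge whose term reaches [p], the two entries of the minimum control Ind(C - F) and the
    link. *)
Lemma nfillable_psi (V : finType) fuel (W : {set V}) (C : {set {set V}}) p :
  is_hypergraph W C -> le_ext p (psi_fuel fuel W C) ->
  nfillable p (geom_real (R := R) (IndOn W C)).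
Proof.
elim: fuel W C p => [|fuel IHfuel] W C p hypC /=.
  by rewrite leqn0 => /eqP -> n.
case: eqP => [_|/eqP W0]; first by rewrite /= leqn0 => /eqP -> n.
have Ind0 W' C' : is_hypergraph W' C' -> finset.set0 \in IndOn W' C'.
  move=> [_ [h _]]; apply/in_IndOn; split; last exact: finset.sub0set.
  by move=> E /h; apply: contraL; rewrite finset.subset0 => /eqP ->; rewrite cards0.
(* Without edges the complex is a full simplex, a cone over any of its vertices. *)
case: eqP => [-> _ n _|_].
  have [w wW] := finset.set0Pn _ W0; apply: (@fillable_cone _ _ _ w).
  - exact: IndOn_down.
  - apply/in_IndOn; split; last exact: finset.sub0set.
    by move=> E; rewrite inE.
  - move=> s /in_IndOn[_ sW]; apply/in_IndOn; split; first by move=> E; rewrite inE.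
    by rewrite finset.subUset finset.sub1set wW.
move=> /le_ext_bigmax[-> //|[F FC pF]].
have [h1 [h2 h3]] := hypC.
have F0 : F != finset.set0 by rewrite -card_gt0; apply: ltnW; exact: h2.
have F1 : (0 < #|F|)%N by rewrite card_gt0.
(* The truncated subtraction is intended: for [p] at most |F| - 1 nothing is demanded of the
   colon. *)
have {pF}[pdel pcol] : le_ext p (psi_fuel fuel W (C :\ F)) /\
    le_ext (p - #|F|.-1) (psi_fuel fuel (colon_vs W C F) (colon_edges C F)).
  move: pF; set x := psi_fuel _ W _; set y := psi_fuel _ _ _.
  case: x y => [a|] [b|] //=.
  - by rewrite leq_min leq_subLR [(_ + b)%N]addnC => /andP[].
  - by rewrite leq_subLR [(_ + b)%N]addnC.
have delfill := IHfuel _ _ _ (is_hypergraph_delete hypC _) pdel.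
have colfill := IHfuel _ _ _ (is_hypergraph_colon hypC _) pcol.
have Ddown := @IndOn_down _ W (C :\ F).
move=> n np; rewrite -(deletion_IndOn W FC).
apply: (fillable_deletion F0 Ddown).
apply: (fillable_open_piece (@open_face_min_lt R V F) (@open_face_min_gt R V F)).
- exact: face_min_cover.
- exact: delfill.
- move=> k kn; apply: fillable_punctured_star => //.
  rewrite (sphere_link_IndOn hypC FC).
  apply: nfillable_boundary_join colfill _ _ => //; last 1 first.
  (* k <= n < p, and p is at most (p - (|F| - 1)) + (|F| - 1) even when the subtraction
     truncates. *)
  + by have := leq_ltn_trans kn np; lia.
  + exact: IndOn_down.
  + exact/Ind0/is_hypergraph_colon.
  + move=> s /in_IndOn[_ sW]; rewrite finset.disjoints_subset.
    apply: fintype.subset_trans sW _; apply/fintype.subsetP => v.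
    by move=> /colon_vsP[_ vF _]; rewrite inE.
Qed.

(** * From fillings of cubes to homotopy groups on round spheres *)

Definition norm2 n (x : 'rV[R]_n) : R := Num.sqrt (\sum_j x ord0 j ^+ 2).

Lemma norm2_gt0 n (x : 'rV[R]_n) : x != 0 -> 0 < norm2 x.
Proof.
move=> x0; rewrite sqrtr_gt0 lt_neqAle sumr_ge0 ?andbT; last first.
  by move=> j _; exact: sqr_ge0.
apply: contra x0; rewrite eq_sym psumr_eq0 => [/allP h|j _]; last exact: sqr_ge0.
apply/eqP/rowP => j; rewrite mxE; apply/eqP.
by have := h j (mem_index_enum j); rewrite sqrf_eq0.
Qed.

Lemma usphere_normalize n (x : 'rV[R]_n.+1) : x != 0 ->
  usphere ((norm2 x)^-1 *: x).
Proof.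
move=> /norm2_gt0 n0; rewrite /usphere /=.
under eq_bigr do rewrite mxE exprMn.
rewrite -mulr_sumr -[X in _ * X]sqr_sqrtr; last first.
  by apply: sumr_ge0 => j _; exact: sqr_ge0.
by rewrite -exprMn mulVf ?expr1n// gt_eqF.
Qed.

Lemma usphere_neq0 n (x : 'rV[R]_n.+1) : usphere x -> x != 0.
Proof.
move=> xs; apply/eqP => x0; move: xs; rewrite x0 /usphere /= => /eqP.
rewrite big1 ?(eq_sym 0) ?oner_eq0// => j _; by rewrite mxE expr0n.
Qed.

Lemma cts_on_norm2 n (A : set 'rV[R]_n) : cts_on A (norm2 (n := n) : _ -> R^o).
Proof.
apply: (@cts_on_comp _ _ _ _ setT _ (Num.sqrt : R^o -> R^o)) => //.
  apply: (@cts_on_sum _ _ _ _ (fun (j : 'I_n) (x : 'rV[R]_n) => x ord0 j ^+ 2 : R^o)).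
  move=> j; have jc := @cts_on_coord _ _ A _ _ j (@cts_on_id R n A).
  by apply: cts_on_eq (cts_onM jc jc) => x _; rewrite expr2.
exact/cts_on_continuous/sqrt_continuous.
Qed.

Lemma usphere_sph_pt i : usphere (sph_pt R i).
Proof.
rewrite /usphere /= (bigD1 ord0)//= mxE eqxx expr1n big1 ?addr0// => j j0.
by rewrite mxE (negbTE j0) expr0n.
Qed.

Lemma norm_sph_pt i : `|sph_pt R i| = 1.
Proof.
apply/le_anti/andP; split.
  apply/rV_norm_le => // j; rewrite mxE; case: ifP => _; by rewrite ?normr1 ?normr0.
have := (rV_norm_le (sph_pt R i) (normr_ge0 _)).1 (lexx _) ord0.
by rewrite mxE eqxx normr1.
Qed.

(** Rescaling carries [f] from the round sphere in R^(i+1) to the boundary of the cube. After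
    filling, each boundary point slides straight to the base point through the convex cube; the base
    point has norm 1 in both norms and stays put. *)
Lemma fillable_pi_trivial n (X : set 'rV[R]_n) i :
  fillable R i.+1 X -> pi_trivial X i.
Proof.
move=> Xfill f /cts_onP fc fX.
have csphere0 (x : 'rV[R]_i.+1) : csphere x -> x != 0.
  by move=> x1; rewrite -normr_gt0 x1.
pose e (x : 'rV[R]_i.+1) := (norm2 x)^-1 *: x.
have [||G [Gc GX Gf]] := Xfill (f \o e).
- apply: cts_on_comp fc; first by move=> x /csphere0; exact: usphere_normalize.
  apply: (@cts_onZ _ _ _ _ (fun x => (norm2 x)^-1)); last exact: cts_on_id.
  apply: cts_onV; last exact: cts_on_norm2.
  by move=> x /csphere0/norm2_gt0/lt0r_neq0.
- by move=> x /csphere0 x0; apply: fX; exists (e x) => //; exact: usphere_normalize.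
pose h (z : 'rV[R]_i.+1 * R) :=
  (1 - z.2) *: (`|z.1|^-1 *: z.1) + z.2 *: sph_pt R i.
have hb z : (@usphere R i `*` @unit_int R) z -> cball (h z).
  move=> [/usphere_neq0/normalize_csphere z1 /andP[t0 t1]].
  rewrite /cball /=; apply: le_trans (ler_normD _ _) _.
  by rewrite !(normrZ z.2, normrZ (1 - z.2)) z1 norm_sph_pt !mulr1 !ger0_norm//; lra.
have eE s : usphere s -> G (`|s|^-1 *: s) = f s.
  move=> su; have s0 := usphere_neq0 su; rewrite Gf; last exact: normalize_csphere.
  congr f; rewrite /e.
  have -> : norm2 (`|s|^-1 *: s) = `|s|^-1.
    rewrite /norm2; under eq_bigr do rewrite mxE exprMn.
    rewrite -mulr_sumr su mulr1 sqrtr_sqr ger0_norm// invr_ge0//.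
  by rewrite invrK scalerA divff ?scale1r// normr_eq0.
have pE : G (sph_pt R i) = f (sph_pt R i).
  by have := eE _ (usphere_sph_pt i); rewrite norm_sph_pt invr1 scale1r.
exists (G \o h); split.
- apply/cts_onP; apply: cts_on_comp hb _ Gc.
  set A := (X in cts_on X).
  have c1 : cts_on A (fun z : 'rV[R]_i.+1 * R => z.1).
    by apply: cts_on_continuous => z; exact: cvg_fst.
  have c2 : cts_on A (fun z : 'rV[R]_i.+1 * R => z.2 : R^o).
    by apply: cts_on_continuous => z; exact: cvg_snd.
  apply: cts_onD; last first.
    by apply: (@cts_onZ _ _ _ _ (fun z : 'rV[R]_i.+1 * R => z.2 : R^o)) => //;
      exact: cts_on_cst.
  apply: (@cts_onZ _ _ _ _ (fun z : 'rV[R]_i.+1 * R => 1 - z.2 : R^o)).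
    by apply: (@cts_onB _ _ _ R^o) => //; exact: cts_on_cst.
  apply: (@cts_onZ _ _ _ _ (fun z : 'rV[R]_i.+1 * R => `|z.1|^-1 : R^o)) => //.
  apply: cts_onV; last exact: cts_on_norm.
  by move=> z [/usphere_neq0 + _]; rewrite normr_eq0.
- by move=> _ [z /hb zb <-]; exact: GX.
- move=> s su; rewrite /= /h /= subr0 scale1r scale0r addr0 eE//.
  by rewrite subrr scale0r add0r scale1r.
- move=> t _; rewrite /= /h /= norm_sph_pt invr1 scale1r -scalerDl subrK scale1r.
  exact: pE.
Qed.

End Connectivity.

Local Close Scope classical_set_scope.

(* conn(Ind(C)) >= psi(C) - 2, with psi(C) = None meaning infinity *)
Theorem theorem1p1 (R : realType) (V : finType) (C : {set {set V}}) :
  is_hypergraph [set: V] C ->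
  forall k : int,
    (if psi [set: V] C is Some p then k + 2 <= p%:Z else true) ->
    conn_ge R (Ind C) k.
Proof.
move=> hypC k kpsi; have [k2|k2] := lerP k (-2); first by left.
(* As k > -2, the number k + 2 is a natural number p bounded by psi, finite or infinite. *)
right; have [p pE] : exists p, k + 2 = p%:Z.
  by exists `|(k + 2)%R|%N; rewrite gez0_abs//; lia.
have IndE : IndOn [set: V]%SET C = Ind C.
  by apply/setP => s; rewrite [LHS]inE finset.subsetT andbT.
have fill : nfillable p (geom_real (R := R) (Ind C)).
  rewrite -IndE; apply: (nfillable_psi (fuel := (#|[set: V]| + #|C|).+1) hypC).
  by move: kpsi; rewrite /psi pE; case: psi_fuel.
split; last by move=> i ik; apply: fillable_pi_trivial; apply: fill; lia.
(* A filling in dimension 0 yields a point: the only vector there has norm 0, so the sphere is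
   empty. *)
have [|||g [_ gX _]] := fill 0%N _ (fun=> 0); first by lia.
- exact: cts_on_cst.
- move=> x /eqP; have -> : x = 0 by apply/rowP => -[].
  by rewrite normr0 eq_sym oner_eq0.
by exists (g 0); apply: gX; rewrite /cball /= normr0.
Qed.
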